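(* Let $0<s<t$ and let $\mu$ be one of the measures below, with $\lambda_c\in(0,\infty]$ defined by $$\lambda_c=\begin{cases}1+\sqrt{1+rs^{-1}}&\text{if }\mu\text{ is the }r\text{-fold convolution of the counting measure on }\mathbb Z_{\ge0}\text{, for an integer }r\ge1,\\2&\text{if }\mu\text{ has density }e^{-ax}x^{\gamma-1}\text{ on }\mathbb R_{\ge0}\text{ w.r.t. Lebesgue measure, for }a\ge0,\ \gamma\ge1,\\\infty&\text{if }\mu\text{ is Poisson or Gaussian.}\end{cases}$$ If $t/s<\lambda_c$, then there is $\delta>0$ depending only on $\mu,s,t$ such that, for all $m,n\ge1$, every $m\times n$ margin $(\mathbf r,\mathbf c)$ satisfying $\mathcal T(\mathbf r,\mathbf c)\cap(A,B)^{m\times n}\ne\emptyset$ and $s\le\mathbf r(i)/n\le t$, $s\le\mathbf c(j)/m\le t$ for all $(i,j)\in[m]\times[n]$ is $\delta$-tame. Furthermore, for $\mu$ equal to any one of these measures (the $r$-fold convolution of the counting measure on $\mathbb Z_{\ge0}$ for an integer $r\ge1$; the measure with density $e^{-ax}x^{\gamma-1}$ on $\mathbb R_{\ge0}$ w.r.t. Lebesgue measure for $a\ge0$, $\gamma\ge1$; Poisson; or Gaussian), with the corresponding $\lambda_c$, if $t/s>\lambda_c$, then there exists a sequence of $n\times n$ margins satisfying these hypotheses (nonempty intersection with $(A,B)^{n\times n}$ and row/column sums divided by $n$ in $[s,t]$) such that some entry of the typical table diverges to infinity as $n\to\infty$.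
   Context: For a $\sigma$-finite Borel measure $\mu$ on $\mathbb R$ let $A=\inf\operatorname{supp}\mu$, $B=\sup\operatorname{supp}\mu$, $\Theta=\{\theta\in\mathbb R:\int e^{\theta x}\mu(dx)<\infty\}$ with interior $\Theta^\circ$, $\psi(\theta)=\log\int e^{\theta x}\mu(dx)$; $\psi':\Theta^\circ\to(A,B)$ is a bijection for the measures considered, with inverse $\phi$. The $r$-fold convolution of the counting measure on $\mathbb Z_{\ge0}$ has mass $\binom{r+i-1}{i}$ at $i\in\mathbb Z_{\ge0}$. An $m\times n$ margin is a pair $(\mathbf r,\mathbf c)\in\mathbb R^m\times\mathbb R^n$; $\mathcal T(\mathbf r,\mathbf c)$ is the set of real $m\times n$ matrices with row sums $\mathbf r$ and column sums $\mathbf c$. An MLE for $(\mathbf r,\mathbf c)$ is a maximizer of $\langle\mathbf r,\boldsymbol\alpha\rangle+\langle\mathbf c,\boldsymbol\beta\rangle-\sum_{i,j}\psi(\boldsymbol\alpha(i)+\boldsymbol\beta(j))$ over $(\boldsymbol\alpha,\boldsymbol\beta)$ with all $\boldsymbol\alpha(i)+\boldsymbol\beta(j)\in\Theta^\circ$. The typical table is the unique minimizer of $\sum_{i,j}[z_{ij}\phi(z_{ij})-\psi(\phi(z_{ij}))]$ over $Z=(z_{ij})\in\mathcal T(\mathbf r,\mathbf c)\cap(A,B)^{m\times n}$; its entries are $\psi'(\boldsymbol\alpha(i)+\boldsymbol\beta(j))$ for any MLE. For $\delta>0$, $A_\delta=\max(A+\delta,-1/\delta)$, $B_\delta=\min(B-\delta,1/\delta)$;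 $(\mathbf r,\mathbf c)$ is $\delta$-tame if an MLE exists and $A_\delta\le\psi'(\boldsymbol\alpha(i)+\boldsymbol\beta(j))\le B_\delta$ for all $i,j$. *)

(* Defs.v *)
From HB Require Import structures.
From mathcomp Require Import all_boot all_order all_algebra.
From mathcomp Require Import all_classical all_reals all_analysis.
From mathcomp Require Import measurable_realfun.

Set Implicit Arguments.
Unset Strict Implicit.
Unset Printing Implicit Defensive.

Import Order.TTheory GRing.Theory Num.Theory.
Import numFieldNormedType.Exports.

Local Open Scope classical_set_scope.
Local Open Scope ring_scope.

Section exponential_family.
Context {R : realType} (mu : {measure set (measurableTypeR R) -> \bar R}).

Definition support : set R :=
  [set x | forall U : set R, open U -> U x -> (0 < mu U)%E].

Definition supp_inf : \bar R := ereal_inf (EFin @` support).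

Definition supp_sup : \bar R := ereal_sup (EFin @` support).

Definition laplace (theta : R) : \bar R :=
  (\int[mu]_x (expR (theta * x))%:E)%E.

Definition Theta : set R := [set theta | (laplace theta < +oo)%E].

(* Only meaningful on [Theta], where [laplace] is finite. *)
Definition psi (theta : R) : R := ln (fine (laplace theta)).

(* Inverse of the bijection psi' : Theta° -> (A, B); junk value 0 elsewhere. *)
Definition phi : R -> R := 'pinv_(fun=> 0) (Theta°) (derive1 psi).

Section margins.
Context {m n : nat}.
Implicit Types (r alpha : 'rV[R]_m) (c beta : 'rV[R]_n) (Z : 'M[R]_(m, n)).

Definition tables r c : set 'M[R]_(m, n) :=
  [set Z | (forall i, \sum_j Z i j = r 0 i) /\
           (forall j, \sum_i Z i j = c 0 j)].

Definition open_box : set 'M[R]_(m, n) :=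
  [set Z | forall i j, (supp_inf < (Z i j)%:E < supp_sup)%E].

Definition dual_feasible alpha beta : Prop :=
  forall i j, (Theta°) (alpha 0 i + beta 0 j).

Definition log_likelihood r c alpha beta : R :=
  \sum_i r 0 i * alpha 0 i + \sum_j c 0 j * beta 0 j
  - \sum_i \sum_j psi (alpha 0 i + beta 0 j).

Definition is_MLE r c alpha beta : Prop :=
  dual_feasible alpha beta /\
  forall alpha' beta', dual_feasible alpha' beta' ->
    log_likelihood r c alpha' beta' <= log_likelihood r c alpha beta.

Definition table_energy Z : R :=
  \sum_i \sum_j (Z i j * phi (Z i j) - psi (phi (Z i j))).

Definition is_typical_table r c Z : Prop :=
  (tables r c `&` open_box) Z /\
  forall Z', (tables r c `&` open_box) Z' -> Z' != Z ->
    table_energy Z < table_energy Z'.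

Definition A_ (delta : R) : \bar R :=
  maxe (supp_inf + delta%:E)%E (- delta^-1)%:E.

Definition B_ (delta : R) : \bar R :=
  mine (supp_sup - delta%:E)%E (delta^-1)%:E.

Definition tame (delta : R) r c : Prop :=
  exists alpha beta, is_MLE r c alpha beta /\
    forall i j,
      (A_ delta <= (derive1 psi (alpha 0 i + beta 0 j))%:E <= B_ delta)%E.

Definition bounded_margin (s t : R) r c : Prop :=
  [/\ tables r c `&` open_box !=set0,
      forall i, s <= r 0 i / n%:R <= t &
      forall j, s <= c 0 j / m%:R <= t].

End margins.
End exponential_family.

(* The measure on [R] with mass [w k] at each natural number [k]. *)
Definition atomic_measure {R : realType} (w : nat -> {nonneg R}) :
    {measure set (measurableTypeR R) -> \bar R} :=
  mseries (fun k => mscale (w k) (\d_(k%:R : measurableTypeR R))) 0.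

Section gamma_measure.
Context {R : realType} (a g : R).

Definition gamma_density (x : R) : R := expR (- (a * x)) * x `^ (g - 1).

(* The restriction to [0, +oo[ is needed: x `^ p is nonzero for x < 0. *)
Definition gamma_measure (A : set (measurableTypeR R)) : \bar R :=
  (\int[lebesgue_measure]_(x in A) ((gamma_density \_ `[0, +oo[) x)%:E)%E.

Let gamma_ge0 x : 0 <= (gamma_density \_ `[0, +oo[) x.
Proof.
by rewrite patchE; case: ifPn => // _; rewrite mulr_ge0 ?expR_ge0 ?powR_ge0.
Qed.

Let measurable_gamma : measurable_fun [set: R] (gamma_density \_ `[0, +oo[).
Proof.
apply/(measurable_restrictT _ _).1 => //; apply: measurable_funTS.
apply: measurable_funM; last exact: measurable_powR.
apply: measurableT_comp => //; apply: measurableT_comp => //.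
Qed.

Let gamma_measure0 : gamma_measure set0 = 0%E.
Proof. by rewrite /gamma_measure integral_set0. Qed.

Let gamma_measure_ge0 A : (0 <= gamma_measure A)%E.
Proof. by apply: integral_ge0 => x _; rewrite lee_fin gamma_ge0. Qed.

Let gamma_measure_sigma_additive : semi_sigma_additive gamma_measure.
Proof.
move=> /= F mF tF mUF; rewrite /gamma_measure; apply: cvg_toP.
  apply: ereal_nondecreasing_is_cvgn => p q pq.
  apply: lee_sum_nneg_natr => // k _ _.
  by apply: integral_ge0 => /= x Fkx; rewrite lee_fin gamma_ge0.
rewrite ge0_integral_bigcup//=.
- by apply/measurable_funTS/measurableT_comp.
- by move=> x _; rewrite lee_fin gamma_ge0.
Qed.

HB.instance Definition _ := isMeasure.Build _ _ _ gamma_measure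
  gamma_measure0 gamma_measure_ge0 gamma_measure_sigma_additive.

End gamma_measure.

Variant base_measure (R : realType) : Type :=
| CountingConv (r : nat) of (0 < r)%N
| GammaDensity (a g : R) of 0 <= a & 1 <= g
| Poisson (rate : R) of 0 < rate
| Gaussian (mean sd : R) of 0 < sd.

Definition base_mu {R : realType} (b : base_measure R) :
    {measure set (measurableTypeR R) -> \bar R} :=
  match b with
  | CountingConv r _ => atomic_measure (fun k => 'C(r + k - 1, k)%:R%:nng)
  | GammaDensity a g _ _ => gamma_measure a g
  | Poisson rate _ =>
      atomic_measure (fun k => NngNum (poisson_pmf_ge0 rate k))
  | Gaussian mean sd _ => normal_prob mean sd
  end.

Definition critical_ratio {R : realType} (b : base_measure R) (s : R) : \bar R :=
  match b with
  | CountingConv r _ => (1 + Num.sqrt (1 + r%:R / s))%:E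
  | GammaDensity _ _ _ _ => 2%:E
  | Poisson _ _ => +oo%E
  | Gaussian _ _ _ => +oo%E
  end.

(* Main.v *)
Require Import Defs.
From HB Require Import structures.
From mathcomp Require Import all_boot all_order all_algebra.
From mathcomp Require Import all_classical all_reals all_analysis.
From mathcomp Require Import measurable_realfun zify ring lra.

Set Implicit Arguments.
Unset Strict Implicit.
Unset Printing Implicit Defensive.

Import Order.TTheory GRing.Theory Num.Theory.
Import numFieldNormedType.Exports.

Local Open Scope classical_set_scope.
Local Open Scope ring_scope.

(* Idea. Each measure has finite Laplace transform exactly on an open half-line
   (or on R), where psi' is an explicit bijection f onto (A, +oo). For a margin
   with an interior table, the log-likelihood is a sum of functions z theta - psi theta with
   bounded superlevel sets, so a maximizer (alpha, beta) exists; stationarity says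
   that f (alpha i + beta j) has the given margins, and strict convexity of psi
   that it is the typical table.
   Let w be the largest entry, p i and q j the other entries in its column and
   row, and z i j a generic entry. Eliminating alpha and beta gives
     z w (k + p + q) = p q (k + z + w)  (counting: k = r; Gamma: k = 0),
     z w = p q  (Poisson),              z + w = p + q  (Gaussian).
   In the first case z <= p q / (k + p + q) + p q / w, and p q / (k + p + q) is
   concave in each variable, so averaging over all entries yields
   s <= t^2 / (k + 2 t) + t^2 / w. The condition t / s < lambda_c says exactly
   that t^2 / (k + 2 t) < s, which bounds w; the other two cases average directly.
   Conversely, if s < t^2 / (k + 2 t), take n x n margins whose first row and
   column sums are t n and all others s n: a corner entry w bounded along a
   subsequence would force p -> t, z -> s and z > p^2 / (k + 2 p), a
   contradiction. *)

(** * Integrals and supports *)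

Section density.
Local Open Scope ereal_scope.
Context d (T : measurableType d) (R : realType).
Variables (mu nu : {measure set T -> \bar R}) (g : T -> R).
Hypotheses (g0 : forall x, (0 <= g x)%R) (mg : measurable_fun setT g).
Hypothesis nuE : forall A, measurable A -> nu A = \int[mu]_(x in A) (g x)%:E.

Import HBNNSimple.

Let mgE : measurable_fun setT (fun x => (g x)%:E).
Proof. exact/measurable_EFinP. Qed.

Let integral_density_nnsfun (h : {nnsfun T >-> R}) :
  \int[nu]_x (h x)%:E = \int[mu]_x ((h x)%:E * (g x)%:E).
Proof.
under eq_integral do rewrite fimfunE -fsumEFin//.
rewrite ge0_integral_fsum//; last 2 first.
- by move=> r; exact/measurable_EFinP/measurableT_comp.
- by move=> n x _; rewrite EFinM nnfun_muleindic_ge0.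
under [RHS]eq_integral => x _.
  rewrite fimfunE -fsumEFin// ge0_mule_fsuml; last first.
    by move=> y; rewrite EFinM nnfun_muleindic_ge0.
  over.
rewrite ge0_integral_fsum//; last 2 first.
- move=> r; apply: emeasurable_funM => //.
  by apply/measurable_EFinP; exact: measurable_funM.
- move=> r x _; rewrite mule_ge0 ?[(0 <= (g x)%:E)%E]lee_fin//.
  by rewrite EFinM nnfun_muleindic_ge0.
apply: eq_fsbigr => r _.
have mr : measurable (h @^-1` [set r]) by [].
have [r0|r0] := leP 0%R r; last first.
  rewrite preimage_nnfun0//.
  under eq_integral do rewrite indic0 mulr0.
  under [RHS]eq_integral do rewrite indic0 mulr0 mul0e.
  by rewrite !integral0.
rewrite integralZl_indic_nnsfun// integral_indic// setIT nuE//.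
under [RHS]eq_integral do rewrite EFinM -muleA.
rewrite ge0_integralZl//; last 2 first.
- by apply: emeasurable_funM => //; exact/measurable_EFinP.
- by move=> x _; rewrite mule_ge0// lee_fin//.
congr (_ * _).
rewrite integral_mkcond; apply: eq_integral => x _.
by rewrite patchE indicE; case: (x \in _); rewrite ?mul1e ?mul0e.
Qed.

(** The formula holds for simple functions by linearity, and both sides pass to the limit along an
    increasing approximation by monotone convergence. *)
Lemma ge0_integral_density (f : T -> \bar R) :
  measurable_fun setT f -> (forall x, 0 <= f x) ->
  \int[nu]_x f x = \int[mu]_x (f x * (g x)%:E).
Proof.
move=> mf f0; pose h := nnsfun_approx measurableT mf.
have ndh x : {homo (fun n => (h n x)%:E) : a b / (a <= b)%N >-> a <= b}.
  by move=> a b ab; rewrite lee_fin; exact/lefP/nd_nnsfun_approx.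
have cvh x : (h n x)%:E @[n --> \oo] --> f x.
  exact: cvg_nnsfun_approx.
have mh n : measurable_fun setT (fun x => (h n x)%:E).
  exact/measurable_EFinP/measurable_funTS.
transitivity (limn (fun n => \int[nu]_x (h n x)%:E)).
  rewrite -monotone_convergence//=.
  - by apply: eq_integral => x _; apply/esym/cvg_lim => //; exact: cvh.
  - by move=> n x _; rewrite lee_fin.
transitivity (limn (fun n => \int[mu]_x ((h n x)%:E * (g x)%:E))).
  by congr (limn _); apply/funext => n; rewrite integral_density_nnsfun.
rewrite -monotone_convergence//=.
- apply: eq_integral => x _; apply/cvg_lim => //.
  by apply: cvgeZr => //; exact: cvh.
- by move=> n; apply: emeasurable_funM.
- by move=> n x _; rewrite mule_ge0 ?lee_fin//.
- by move=> x _ a b ab; apply: lee_wpmul2r; [rewrite lee_fin|exact: ndh].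
Qed.

End density.

Section atomic.
Context {R : realType}.
Implicit Types (w : nat -> {nonneg R}) (f : R -> R).

Lemma integral_atomic w f : measurable_fun setT f -> (forall x, 0 <= f x) ->
  (\int[atomic_measure w]_x (f x)%:E =
   \sum_(0 <= k <oo) ((w k)%:num * f k%:R)%:E)%E.
Proof.
move=> mf f0; rewrite ge0_integral_measure_series//.
- apply: eq_eseriesr => k _.
  rewrite ge0_integral_mscale//.
  + by rewrite integral_dirac// ?diracT ?mul1e ?EFinM//; exact/measurable_EFinP.
  + exact/measurable_EFinP.
  + by move=> x _; rewrite lee_fin.
- by move=> x _; rewrite lee_fin.
- exact/measurable_EFinP.
Qed.

Lemma atomic_measureE w (A : set R) : measurable A ->
  (atomic_measure w A = \sum_(0 <= k <oo) ((w k)%:num * \1_A k%:R)%:E)%E.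
Proof. by move=> mA; apply: eq_eseriesr => k _; rewrite /= /mscale/= diracE. Qed.

Lemma support_atomic w k : 0 < (w k)%:num -> Defs.support (atomic_measure w) k%:R.
Proof.
move=> wk U oU Uk; rewrite atomic_measureE; last exact: open_measurable.
rewrite (@nneseriesD1 _ _ k)//.
rewrite indicE mem_set// mulr1.
apply: (@lt_le_trans _ _ (w k)%:num%:E); first by rewrite lte_fin.
rewrite leeDl//; apply: nneseries_ge0 => j _ _.
by rewrite lee_fin mulr_ge0.
Qed.

End atomic.

Section support_bounds.
Context {R : realType} (mu : {measure set (measurableTypeR R) -> \bar R}).

(** Support points arbitrarily close to [l] suffice. This suits Gamma measures, whose density may
    vanish at the endpoint 0. *)
Lemma supp_inf_eq (l : R) :
    (forall e, 0 < e -> exists2 x, x < l + e & Defs.support mu x) ->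
  mu `]-oo, l[%classic = 0%E -> supp_inf mu = l%:E.
Proof.
move=> sl mul; apply/eqP; rewrite eq_le; apply/andP; split.
  apply/lee_addgt0Pr => e /sl[x xl sx].
  apply: (@le_trans _ _ x%:E); last by rewrite lee_fin ltW.
  by apply: ereal_inf_lbound; exists x.
apply: le_ereal_inf_tmp => _ [x sx <-]; rewrite lee_fin leNgt; apply/negP => xl.
have : (0 < mu `]-oo, l[%classic)%E.
  by apply: sx; [exact: interval_open|rewrite /= in_itv].
by rewrite mul ltxx.
Qed.

Lemma supp_sup_eqy :
  (forall M, exists2 x, M <= x & Defs.support mu x) -> supp_sup mu = +oo%E.
Proof.
move=> h; apply: eq_infty => M; have [x Mx sx] := h M.
apply: (@le_trans _ _ x%:E); first by rewrite lee_fin.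
by apply: ereal_sup_ubound; exists x.
Qed.

Lemma supp_inf_eqNy :
  (forall M, exists2 x, x <= M & Defs.support mu x) -> supp_inf mu = -oo%E.
Proof.
move=> h; apply: eq_ninfty => M; have [x Mx sx] := h M.
apply: (@le_trans _ _ x%:E); last by rewrite lee_fin.
by apply: ereal_inf_lbound; exists x.
Qed.

(** Every neighbourhood of [x] contains some [[x, x + d]] with [d <= 1], whose mass is at least
    [c * d]; control to the right of [x] is enough. *)
Lemma support_density (g : R -> R) (x c : R) :
    measurable_fun setT g -> (forall y, 0 <= g y) ->
    (forall A, measurable A ->
      mu A = (\int[lebesgue_measure]_(y in A) (g y)%:E)%E) ->
    0 < c -> (forall y, x <= y <= x + 1 -> c <= g y) ->
  Defs.support mu x.
Proof.
move=> mg g0 muE c0 cg U oU Ux.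
have /nbhs_ballP[e /= e0 eU] := open_nbhs_nbhs (conj oU Ux).
pose d := Num.min (e / 2) 1.
have d0 : 0 < d by rewrite lt_min ltr01 divr_gt0.
have dU : `[x, x + d]%classic `<=` U.
  move=> y /=; rewrite in_itv/= => /andP[xy yd]; apply: eU.
  rewrite /ball/= ler0_norm ?subr_le0// opprB.
  have : d <= e / 2 by rewrite ge_min lexx.
  lra.
have mdE : (mu `[x, (x + d)%R]%classic <= mu U)%E.
  by apply: le_measure; rewrite ?inE//; exact: open_measurable.
apply: lt_le_trans mdE; rewrite muE//.
apply: (@lt_le_trans _ _
  (\int[lebesgue_measure]_(y in `[x, (x + d)%R]) (cst c%:E y))%E).
  rewrite integral_cst//= lebesgue_measure_itv/= lte_fin ltrDl d0 -EFinB -EFinM.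
  by rewrite lte_fin addrAC subrr add0r mulr_gt0.
apply: ge0_le_integral => //=.
- by move=> y _; rewrite lee_fin ltW.
- by apply/measurable_EFinP; exact: measurable_funTS.
- move=> y; rewrite in_itv/= lee_fin => /andP[xy yd]; apply: cg.
  rewrite xy/=; apply: (le_trans yd); rewrite lerD2l.
  by rewrite ge_min lexx orbT.
Qed.

End support_bounds.

(** * Laplace transforms *)

Section gamma.
Context {R : realType}.
Implicit Types a c g x : R.

Local Notation gd c g := (gamma_density c g \_ `[0, +oo[).

Lemma measurable_gamma_density c g : measurable_fun setT (gd c g).
Proof.
apply/(measurable_restrictT _ _).1 => //; apply: measurable_funTS.
apply: measurable_funM; last exact: measurable_powR.
by apply: measurableT_comp => //; exact: measurableT_comp.
Qed.

Lemma gamma_density_ge0 c g x : 0 <= gd c g x.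
Proof.
by rewrite patchE; case: ifPn => // _; rewrite mulr_ge0 ?expR_ge0 ?powR_ge0.
Qed.

(** Tilting by [expR (theta * x)] turns the parameter [a] into [a - theta], so only total masses of
    Gamma measures have to be studied. *)
Lemma laplace_gamma a g (theta : R) :
  laplace (gamma_measure a g) theta = gamma_measure (a - theta) g setT.
Proof.
rewrite /laplace (@ge0_integral_density _ _ _ lebesgue_measure _ (gd a g)) //=.
- apply: eq_integral => x _; rewrite -EFinM; congr EFin.
  rewrite !patchE; case: ifPn; rewrite ?mulr0// => _.
  rewrite /gamma_density mulrA -expRD; congr (expR _ * _); ring.
- exact: gamma_density_ge0.
- exact: measurable_gamma_density.
- by apply/measurable_EFinP; apply: measurableT_comp => //; exact: measurable_funM.
Qed.

Let measurable_scale c :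
  measurable_fun setT ( *%R c : measurableTypeR R -> measurableTypeR R).
Proof. exact: measurable_funM. Qed.

Let scaled_lebesgue c : {measure set (measurableTypeR R) -> \bar R} :=
  measure_function_pushforward__canonical__measure_function_Measure
    lebesgue_measure (measurable_scale c).

Let lebesgue_measure_scale c (c0 : 0 < c) (A : set (measurableTypeR R)) :
  measurable A ->
  mscale (NngNum (ltW c0)) (scaled_lebesgue c) A = lebesgue_measure A.
Proof.
move=> mA; apply/esym/lebesgue_measure_unique => //= _ [[a b]] _ <-.
rewrite /mscale/= /pushforward.
rewrite (_ : _ @^-1` _ = `](a / c), (b / c)]%classic); last first.
  apply/seteqP; split => x /=; rewrite !in_itv/=;
    by rewrite ltr_pdivrMr// ler_pdivlMr// (mulrC c).
rewrite !lebesgue_measure_itv/= !lte_fin ltr_pM2r ?invr_gt0//.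
case: ifPn => _; last by rewrite mule0.
by rewrite -!EFinB -EFinM; congr EFin; field; rewrite gt_eqF.
Qed.

(** Substitution [x -> c * x] in the integral. It yields the dependence of the Laplace transform on
    [theta] without evaluating the Gamma function. *)
Lemma gamma_measure_scale c g : 0 < c -> 0 < g ->
  gamma_measure 1 g setT = ((c `^ g)%:E * gamma_measure c g setT)%E.
Proof.
move=> c0 g0; rewrite /gamma_measure.
have mg a : measurable_fun setT (fun x => (gd a g x)%:E).
  by apply/measurable_EFinP; exact: measurable_gamma_density.
have pg a x : (0 <= (gd a g x)%:E)%E by rewrite lee_fin gamma_density_ge0.
rewrite -(@eq_measure_integral _ _ _ _ lebesgue_measure
  (mscale (NngNum (ltW c0)) (scaled_lebesgue c))); last first.
  by move=> A mA _; apply: lebesgue_measure_scale.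
rewrite ge0_integral_mscale//=; last exact: mg.
have -> : (\int[scaled_lebesgue c]_x (gd 1 g x)%:E =
    \int[lebesgue_measure]_x (gd 1 g (c * x))%:E)%E.
  exact: (ge0_integral_pushforward (measurable_scale c) lebesgue_measure
    measurableT (mg 1)).
rewrite -[RHS]ge0_integralZl; last 4 first.
- exact: measurableT.
- exact: mg.
- by move=> x _; exact: pg.
- by rewrite lee_fin powR_ge0.
rewrite -[LHS]ge0_integralZl; last 4 first.
- exact: measurableT.
- exact: measurableT_comp (mg 1) (measurable_scale c).
- by move=> x _; exact: pg.
- by rewrite lee_fin ltW.
apply: eq_integral => x _; rewrite -!EFinM; congr EFin.
rewrite !patchE.
have -> : (c * x \in `[0, +oo[%classic) = (x \in `[0, +oo[%classic).
  apply/idP/idP; rewrite !inE/= !in_itv/= !andbT pmulr_rge0//.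
case: ifPn; rewrite ?mulr0//; rewrite inE/= in_itv/= andbT => x0.
rewrite /gamma_density powRM//; last exact: ltW.
by rewrite -[in RHS](mulr_powRB1 (ltW c0))// mul1r; ring.
Qed.

Let gamma_density_bound p x : 0 <= p -> 0 <= x ->
  expR (- x) * x `^ p <= (2 * (p + 1)) `^ p * expR (- (x / 2)).
Proof.
move=> p0 x0; set K := 2 * (p + 1).
have K0 : 0 < K by rewrite /K; lra.
have -> : expR (- x) = expR (- (x / 2)) * expR (- (x / 2)).
  by rewrite -expRD; congr expR; lra.
rewrite mulrAC; apply: ler_pM; rewrite ?mulr_ge0 ?expR_ge0 ?powR_ge0//.
have -> : x `^ p = K `^ p * (x / K) `^ p.
  rewrite -powRM ?divr_ge0 ?(ltW K0)//; congr (_ `^ _).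
  by field; rewrite gt_eqF.
rewrite mulrCA -[leRHS]mulr1 ler_pM2l ?powR_gt0//.
rewrite expRN ler_pdivrMl ?expR_gt0// mulr1.
have := @expR_ge1Dx _ (x / K) => h.
apply: (@le_trans _ _ (expR (x / K) `^ p)).
  apply: ge0_ler_powR => //; rewrite ?nnegrE ?divr_ge0 ?expR_ge0 ?(ltW K0)//.
  by apply: le_trans h; rewrite lerDr.
rewrite -expRM ler_expR -mulrA ler_wpM2l// ler_pdivrMl// /K; lra.
Qed.

Lemma gamma_measure_lty c g : 0 < c -> 1 <= g -> (gamma_measure c g setT < +oo)%E.
Proof.
move=> c0 g1.
suff : (gamma_measure 1 g setT < +oo)%E.
  rewrite (@gamma_measure_scale c)//; last by apply: lt_le_trans g1.
  apply: contraTT; rewrite -!leNgt !leye_eq => /eqP ->.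
  by rewrite gt0_muley// lte_fin powR_gt0.
have r0 : 0 <= 2^-1 :> R by lra.
(* The density is dominated by [M] times the exponential density of rate 1/2; the leading factor 2
   cancels that rate. *)
pose M := 2 * (2 * (g - 1 + 1)) `^ (g - 1).
have M0 : 0 <= M by rewrite mulr_ge0// powR_ge0.
apply: (@le_lt_trans _ _
  (\int[lebesgue_measure]_x (M%:E * (exponential_pdf 2^-1 x)%:E))%E).
  apply: ge0_le_integral => //=.
  - by move=> x _; rewrite lee_fin gamma_density_ge0.
  - by apply/measurable_EFinP; exact: measurable_gamma_density.
  - apply/measurable_EFinP; apply: measurable_funM => //.
    exact: measurable_exponential_pdf.
  - move=> x _; rewrite lee_fin.
    have [x0|x0] := ltP x 0.
      rewrite lt0_exponential_pdf// mulr0 patchE memNset//=.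
      by rewrite in_itv/= andbT; apply/negP; rewrite -ltNge.
    rewrite exponential_pdfE// patchE mem_set//=; last by rewrite in_itv/= x0.
    rewrite /gamma_density mul1r /M mulrA.
    rewrite [X in _ <= X * _](_ : _ = (2 * (g - 1 + 1)) `^ (g - 1)); last by field.
    by rewrite mulNr (mulrC 2^-1); apply: gamma_density_bound => //; lra.
rewrite ge0_integralZl//=.
- by rewrite integral_exponential_pdf ?mule1 ?ltry//; lra.
- by apply/measurable_EFinP; exact: measurable_exponential_pdf.
- by move=> x _; rewrite lee_fin exponential_pdf_ge0.
Qed.

Lemma gamma_measure_gt0 g : 1 <= g -> (0 < gamma_measure 1 g setT)%E.
Proof.
move=> g1.
apply: (@lt_le_trans _ _
  (\int[lebesgue_measure]_(x in `[1%R, 2%R]) (cst (expR (- 2))%:E x))%E).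
  rewrite integral_cst//= lebesgue_measure_itv/= lte_fin ltr1n -EFinB -EFinM.
  by rewrite lte_fin mulr_gt0 ?expR_gt0//; lra.
rewrite /gamma_measure integral_mkcond; apply: ge0_le_integral => //=.
- by move=> x _; rewrite patchE; case: ifPn => // _; rewrite lee_fin expR_ge0.
- by apply/(measurable_restrictT _ _).1.
- by apply/measurable_EFinP; exact: measurable_gamma_density.
- move=> x _; rewrite patchE; case: ifPn; last first.
    by rewrite lee_fin gamma_density_ge0.
  rewrite inE/= in_itv/= => /andP[x1 x2]; rewrite lee_fin patchE mem_set/=; last first.
    by rewrite in_itv/= andbT; lra.
  rewrite /gamma_density -[leLHS]mulr1; apply: ler_pM => //.
    by rewrite ler_expR; lra.
  by rewrite -[leLHS](powRr0 x); apply: ler_powR; lra.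
Qed.

Lemma gamma_measure_eqy c g : c <= 0 -> 1 <= g -> gamma_measure c g setT = +oo%E.
Proof.
move=> c0 g1; apply/eqP; rewrite -leye_eq.
apply: (@le_trans _ _
  (\int[lebesgue_measure]_(x in `[1%R, +oo[) (cst 1%E x))%E).
  by rewrite integral_cst//= lebesgue_measure_itv/= ltry/= mul1e.
rewrite /gamma_measure integral_mkcond; apply: ge0_le_integral => //=.
- by move=> x _; rewrite patchE; case: ifPn.
- by apply/(measurable_restrictT _ _).1.
- by apply/measurable_EFinP; exact: measurable_gamma_density.
- move=> x _; rewrite patchE; case: ifPn; last first.
    by rewrite lee_fin gamma_density_ge0.
  rewrite inE/= in_itv/= andbT => x1; rewrite lee_fin patchE mem_set/=; last first.
    by rewrite in_itv/= andbT; lra.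
  rewrite /gamma_density -[leLHS]mulr1; apply: ler_pM => //.
    by rewrite -[leLHS](expR0) ler_expR oppr_ge0 mulr_le0_ge0//; lra.
  by rewrite -[leLHS](powRr0 x); apply: ler_powR; lra.
Qed.

End gamma.

(** * Gaussian Laplace transform *)

Section gaussian.
Context {R : realType}.
Implicit Types (m s theta : R).

(** Completing the square: the tilted density is a constant times the normal density with mean
    [m + s ^+ 2 * theta]. *)
Lemma laplace_normal m s theta : s != 0 ->
  laplace (normal_prob m s) theta =
  (expR (m * theta + s ^+ 2 * theta ^+ 2 / 2))%:E.
Proof.
move=> s0.
rewrite /laplace (@ge0_integral_density _ _ _ lebesgue_measure _ (normal_pdf m s))//=.
- transitivity (\int[lebesgue_measure]_x
      ((expR (m * theta + s ^+ 2 * theta ^+ 2 / 2))%:E *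
       (normal_pdf (m + s ^+ 2 * theta) s x)%:E))%E.
    apply: eq_integral => x _; rewrite -!EFinM; congr EFin.
    rewrite !normal_pdfE// mulrCA [RHS]mulrCA; congr (_ * _).
    rewrite /normal_fun -!expRD; congr expR; field; exact: s0.
  rewrite ge0_integralZl//= ?integral_normal_pdf ?mule1//.
  + by apply/measurable_EFinP; exact: measurable_normal_pdf.
  + by move=> x _; rewrite lee_fin normal_pdf_ge0.
- by move=> x; exact: normal_pdf_ge0.
- exact: measurable_normal_pdf.
- by apply/measurable_EFinP; apply: measurableT_comp => //; exact: measurable_funM.
Qed.

End gaussian.

(** * Laplace transforms of atomic measures as power series *)

Section series.
Context {R : realType}.
Implicit Types (x theta : R) (w : nat -> {nonneg R}).

Lemma laplace_atomic w theta : laplace (atomic_measure w) theta =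
  (\sum_(0 <= k <oo) ((w k)%:num * expR theta ^+ k)%:E)%E.
Proof.
rewrite /laplace integral_atomic//.
- by apply: eq_eseriesr => k _; rewrite expRM_natr.
- by apply: measurableT_comp => //; exact: measurable_funM.
Qed.

(** Negative binomial series, by induction on [r]: Pascal's rule relates the partial sums for [r.+1]
    and [r], and in the limit the sum [l] solves [l = ((1 - x) ^+ r)^-1 + x * l]. *)
Lemma cvg_geometric_binomial (x : R) r : 0 <= x -> x < 1 ->
  series (fun k => 'C(r + k - 1, k)%:R * x ^+ k) @ \oo --> ((1 - x) ^+ r)^-1.
Proof.
move=> x0 x1; set u := fun r k => 'C(r + k - 1, k)%:R * x ^+ k : R.
have u0 s k : 0 <= u s k by rewrite mulr_ge0// exprn_ge0.
elim: r => [|r IH].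
  (* For [r = 0] only the term [k = 0] survives: truncated subtraction makes it ['C(0, 0) = 1], and
     ['C(k - 1, k) = 0] for [k > 0]. *)
  rewrite expr0 invr1; apply: cvg_near_cst; near=> n.
  have n1 : (0 < n)%N by near: n; exists 1%N.
  rewrite /series/= -(prednK n1) big_nat_recl//= big1_seq ?addr0.
    by rewrite bin0 expr0 mulr1.
  by move=> k _; rewrite add0n subn1/= bin_small ?mul0r.
have rec n : series (u r.+1) n.+1 = series (u r) n.+1 + x * series (u r.+1) n.
  rewrite /series/= !big_nat_recl// mulr_sumr -addrA -big_split/=; congr (_ + _).
    by rewrite /u !bin0.
  apply: eq_bigr => k _; rewrite /u.
  have -> : (r.+1 + k.+1 - 1 = (r + k).+1)%N by lia.
  have -> : (r + k.+1 - 1 = r + k)%N by lia.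
  have -> : (r.+1 + k - 1 = r + k)%N by lia.
  by rewrite binS natrD exprS; ring.
have nd s : nondecreasing_seq (series (u s)).
  by apply/nondecreasing_seqP => n; rewrite seriesSr lerDl.
(* Monotonicity and [rec] give [S n <= S n.+1 <= ((1 - x) ^+ r)^-1 + x * S n], which is solved for
   [S n]. *)
have ub n : series (u r.+1) n <= ((1 - x) ^+ r.+1)^-1.
  have : series (u r.+1) n <= series (u r.+1) n.+1 by apply: nd.
  rewrite rec.
  have : series (u r) n.+1 <= ((1 - x) ^+ r)^-1.
    rewrite -(cvg_lim (@Rhausdorff R) IH).
    by apply: nondecreasing_cvgn_le => //; apply/cvg_ex; eexists; exact: IH.
  rewrite exprS invfM => h1 h2.
  rewrite ler_pdivlMl; last lra.
  lra.
have cv : cvgn (series (u r.+1)).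
  by apply: nondecreasing_is_cvgn => //; exists ((1 - x) ^+ r.+1)^-1 => _ [n _ <-].
have [l cl] := (cvg_ex _).1 cv.
suff <- : l = ((1 - x) ^+ r.+1)^-1 by [].
have cl1 : series (u r.+1) n.+1 @[n --> \oo] --> l.
  by move: cl; rewrite -(cvg_shiftS (series _)).
have cl2 : series (u r.+1) n.+1 @[n --> \oo] --> ((1 - x) ^+ r)^-1 + x * l.
  rewrite (funext rec).
  apply: cvgD; first by move: IH; rewrite -(cvg_shiftS (series _)).
  by apply: cvgM cl; exact: cvg_cst.
have e : l = ((1 - x) ^+ r)^-1 + x * l by exact: cvg_unique cl1 cl2.
rewrite exprS invfM -(_ : (1 - x) * l = ((1 - x) ^+ r)^-1); last lra.
by rewrite mulKf//; apply/eqP; lra.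
Unshelve. all: by end_near. Qed.

Lemma eseries_cvg (u : R ^nat) (l : R) : series u @ \oo --> l ->
  (\sum_(0 <= k <oo) (u k)%:E)%E = l%:E.
Proof.
move=> ul; apply/cvg_lim => //.
rewrite (_ : (fun n => _) = EFin \o series u); last first.
  by apply/funext => n /=; rewrite /series/= sumEFin.
by apply: cvg_EFin => /=; [exact: nearW|exact: ul].
Qed.

Lemma laplace_counting r theta : theta < 0 ->
  laplace (atomic_measure (fun k => 'C(r + k - 1, k)%:R%:nng)) theta =
  (((1 - expR theta) ^+ r)^-1)%:E.
Proof.
move=> t0; rewrite laplace_atomic; apply: eseries_cvg.
by apply: cvg_geometric_binomial; rewrite ?expR_ge0 ?expR_lt1.
Qed.

Lemma laplace_counting_eqy r theta : (0 < r)%N -> 0 <= theta ->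
  laplace (atomic_measure (fun k => 'C(r + k - 1, k)%:R%:nng)) theta = +oo%E.
Proof.
move=> r0 t0; rewrite laplace_atomic; apply/eqP; rewrite -leye_eq.
apply: (@le_trans _ _ (\sum_(0 <= k <oo) (1%:E : \bar R))%E).
  rewrite leye_eq; apply/eqP/eq_infty => x.
  apply: (@le_trans _ _ (Num.truncn x).+1%:R%:E).
    by rewrite lee_fin ltW// truncnS_gt.
  apply: le_trans (nneseries_lim_ge (Num.truncn x).+1 _) => //.
  by rewrite sumEFin lee_fin sumr_const_nat subn0.
apply: lee_nneseries => // k _; rewrite lee_fin.
apply: mulr_ege1; first by rewrite ler1n bin_gt0; lia.
by rewrite exprn_ege1// -expR0 ler_expR.
Qed.

Lemma laplace_poisson (rate theta : R) : 0 < rate ->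
  laplace (atomic_measure (fun k => NngNum (poisson_pmf_ge0 rate k))) theta =
  (expR (rate * (expR theta - 1)))%:E.
Proof.
move=> r0; rewrite laplace_atomic; apply: eseries_cvg.
have -> : expR (rate * (expR theta - 1)) =
    expR (- rate) * expR (rate * expR theta).
  by rewrite -expRD; congr expR; ring.
rewrite (_ : series _ =
    fun n => expR (- rate) * series (exp_coeff (rate * expR theta)) n).
  by apply: cvgM; [exact: cvg_cst|exact: is_cvg_series_exp_coeff].
apply/funext => n; rewrite /series/= mulr_sumr; apply: eq_bigr => k _.
by rewrite /poisson_pmf r0 /exp_coeff/= exprMn; ring.
Qed.

End series.

(** * Cumulant functions on a half-line *)

(* [Psi] only stands for [psi mu]: keeping it a variable prevents unification
   from unfolding the Laplace integral. [f] is the derivative of [psi mu] and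
   [g] its inverse. *)
Record steep_family (R : realType)
    (mu : {measure set (measurableTypeR R) -> \bar R})
    (A e : \bar R) (Psi f g : R -> R) : Prop := SteepFamily {
  steep_psi : psi mu = Psi ;
  steep_inf : supp_inf mu = A ;
  steep_sup : supp_sup mu = +oo%E ;
  steep_dom : (Theta mu)° = [set th | (th%:E < e)%E] ;
  steep_derive : forall th, (th%:E < e)%E -> is_derive th 1 Psi (f th) ;
  steep_incr : forall x y, (y%:E < e)%E -> x < y -> f x < f y ;
  steep_range : forall th, (th%:E < e)%E -> (A < (f th)%:E)%E ;
  steep_inv : forall z, (A < z%:E)%E -> ((g z)%:E < e)%E /\ f (g z) = z ;
  steep_coercive : forall z K, (A < z%:E)%E -> exists2 h, (h%:E < e)%E &
    forall th, (th%:E < e)%E -> K <= z * th - Psi th -> th <= h }.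

Section steep_family_theory.
Context {R : realType} (mu : {measure set (measurableTypeR R) -> \bar R}).
Context (A e : \bar R) (Psi f g : R -> R).
Hypothesis H : steep_family mu A e Psi f g.
Local Notation dom th := (th%:E < e)%E.

Lemma steep_dom_le x y : x <= y -> dom y -> dom x.
Proof. by move=> xy; apply: le_lt_trans; rewrite lee_fin. Qed.

Lemma steep_derive1 th : dom th -> derive1 (psi mu) th = f th.
Proof.
move=> dth; rewrite (steep_psi H) derive1E.
by have D := steep_derive H dth; rewrite derive_val.
Qed.

Lemma steep_continuous th : dom th -> {for th, continuous Psi}.
Proof.
move=> dth; apply/differentiable_continuous/derivable1_diffP.
by have [] := steep_derive H dth.
Qed.

Lemma steep_MVT x y : x < y -> dom y ->
  exists2 c, x < c < y & Psi y - Psi x = f c * (y - x).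
Proof.
move=> xy dy.
have dI u : u \in `]x, y[ -> is_derive u 1 Psi (f u).
  move=> uxy; apply: (steep_derive H); apply: steep_dom_le dy.
  by rewrite ltW ?(itvP uxy).
have cI : {within `[x, y], continuous Psi}.
  apply: derivable_within_continuous => u uxy.
  suff du : dom u by have [] := steep_derive H du.
  by apply: steep_dom_le dy; rewrite (itvP uxy).
have [c cxy E] := MVT xy dI cI.
by exists c; rewrite ?(itvP cxy).
Qed.

Lemma steep_tangent_lt x y : dom x -> dom y -> x != y ->
  Psi y + f y * (x - y) < Psi x.
Proof.
move=> dx dy; rewrite neq_lt => /orP[xy|yx].
- have [c /andP[xc cy] E] := steep_MVT xy dy.
  have := steep_incr H dy cy; move: E; move: (Psi x) (Psi y) => a b E fcy.
  have : f c * (y - x) < f y * (y - x) by rewrite ltr_pM2r// subr_gt0.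
  lra.
- have [c /andP[yc cx] E] := steep_MVT yx dx.
  have := steep_incr H (steep_dom_le (ltW cx) dx) yc.
  move: E; move: (Psi x) (Psi y) => a b E fyc.
  have : f y * (x - y) < f c * (x - y) by rewrite ltr_pM2r// subr_gt0.
  lra.
Qed.

Lemma steep_tangent x y : dom x -> dom y -> Psi y + f y * (x - y) <= Psi x.
Proof.
move=> dx dy; have [->|xy] := eqVneq x y; first by rewrite subrr mulr0 addr0.
exact/ltW/steep_tangent_lt.
Qed.

Lemma steep_le_mono x y : dom x -> dom y -> (f x <= f y) = (x <= y).
Proof.
move=> dx dy; rewrite !leNgt; congr (~~ _); apply/idP/idP => [|yx].
  apply: contraTT; rewrite -!leNgt le_eqVlt => /predU1P[->//|xy].
  exact/ltW/(steep_incr H).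
exact: (steep_incr H).
Qed.

Lemma steep_lt_mono x y : dom x -> dom y -> (f x < f y) = (x < y).
Proof. by move=> dx dy; rewrite !ltNge steep_le_mono. Qed.

Lemma steep_inj x y : dom x -> dom y -> f x = f y -> x = y.
Proof.
move=> dx dy fxy; apply/eqP; rewrite eq_le.
by rewrite -(steep_le_mono dx dy) -(steep_le_mono dy dx) fxy lexx.
Qed.

Lemma steep_invK th : dom th -> g (f th) = th.
Proof.
by move=> dth; have [dg E] := steep_inv H (steep_range H dth); exact: steep_inj.
Qed.

(** [phi] is a partial inverse obtained by choice; injectivity of the derivative on the domain
    identifies it with the explicit [g]. *)
Lemma steep_phi z : (A < z%:E)%E -> phi mu z = g z.
Proof.
move=> Az; have [dg fg] := steep_inv H Az.
have EI : {in ((Theta mu)° : set R) &, injective (derive1 (psi mu))}.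
  move=> x y; rewrite !inE (steep_dom H) /= => dx dy.
  by rewrite !steep_derive1//; exact: steep_inj.
have := pinvKV (fun=> 0) EI (_ : g z \in ((Theta mu)° : set R)).
rewrite steep_derive1// fg; apply.
by rewrite inE (steep_dom H).
Qed.

(** The upper bound is coercivity. For the lower one, the tangent to [Psi] at [g z - 1] has slope
    below [z], so [z * th - Psi th] lies under an increasing affine function of [th]. *)
Lemma steep_superlevel z K : (A < z%:E)%E -> exists lo hi, dom hi /\
  forall th, dom th -> K <= z * th - Psi th -> lo <= th <= hi.
Proof.
move=> Az; have [h dh hP] := steep_coercive H K Az.
have [dg fg] := steep_inv H Az.
have g1 : g z - 1 < g z by rewrite ltrBlDr ltrDl.
have dg1 := steep_dom_le (ltW g1) dg.
have fz := steep_incr H dg g1; rewrite fg in fz.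
set y := g z - 1 in g1 dg1 fz.
exists (y + (K - (z * y - Psi y)) / (z - f y)); exists h; split => // th dth Kth.
rewrite hP// andbT -lerBrDl ler_pdivrMr ?subr_gt0//.
have := steep_tangent dth dg1; move: Kth.
by move: (Psi th) (Psi y) => a b; lra.
Qed.

(** Fenchel-Young inequality: the concave function [z * th - Psi th] is stationary, hence maximal,
    at [g z]. *)
Lemma steep_ub z th : (A < z%:E)%E -> dom th ->
  z * th - Psi th <= z * g z - Psi (g z).
Proof.
move=> Az dth; have [dg fg] := steep_inv H Az.
have := steep_tangent dth dg; rewrite fg.
by move: (Psi th) (Psi (g z)) => a b; lra.
Qed.

Lemma steep_dense x : dom x -> exists2 y, x < y & dom y.
Proof.
move=> dx; have Af := steep_range H dx.
have Af1 : (A < (f x + 1)%:E)%E.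
  by apply: (lt_trans Af); rewrite lte_fin ltrDl.
have [dg fg] := steep_inv H Af1; exists (g (f x + 1)) => //.
by rewrite -steep_lt_mono// fg ltrDl.
Qed.

(** First-order condition for a common shift [t] of all the parameters, at its maximum [t = 0]. *)
Lemma steep_stationary k (th : 'I_k -> R) (s : R) : (forall j, dom (th j)) ->
  (forall t, (forall j, dom (th j + t)) ->
    t * s - \sum_j Psi (th j + t) <= - \sum_j Psi (th j)) ->
  \sum_j f (th j) = s.
Proof.
move=> dth max.
(* The domain is closed downwards, so only the largest [th j] limits the shift. With no index at
   all, any [d] works. *)
have [d d0 dd] : exists2 d, 0 < d & forall t, t < d -> forall j, dom (th j + t).
  case: k th dth {max} => [|k] th dth; first by exists 1 => // t _ [].
  have [y My dy] : exists2 y, \big[Num.max/th ord0]_j th j < y & dom y.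
    apply: steep_dense; elim/big_ind : _ => // a b da db.
    by rewrite /Num.max; case: ifP.
  exists (y - \big[Num.max/th ord0]_j th j); first by rewrite subr_gt0.
  move=> t td j; apply: steep_dom_le dy.
  have := le_bigmax (th ord0) th j; lra.
pose F := (fun t => t * s) - \sum_j (Psi \o (fun t => th j + t)).
have FE t : F t = t * s - \sum_j Psi (th j + t).
  by rewrite /F !fctE /= fct_sumE.
have dF t : t < d -> is_derive t 1 F (s - \sum_j f (th j + t)).
  move=> td; rewrite /F; apply: is_deriveB.
    rewrite (_ : (fun t => t * s) = s *: id); last first.
      by apply/funext => x; rewrite /= fctE mulrC.
    by apply: is_derive_eq; rewrite /GRing.scale/= mulr1.
  apply: is_derive_sum => j.
  rewrite -[f _]mulr1; apply: is_derive1_comp.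
    exact: (steep_derive H (dd _ td j)).
  rewrite (_ : (fun t => th j + t) = shift (th j)); first exact: is_derive_shift.
  by apply/funext => x; rewrite /= addrC.
have D0 : is_derive (0 : R) 1 F 0.
  apply: (@derive1_at_max _ F (- d) d 0); first lra.
  - by move=> t; rewrite in_itv/= => /andP[_ /dF[]].
  - by rewrite in_itv/= d0 oppr_lt0 d0.
  - move=> t; rewrite in_itv/= => /andP[_ td]; rewrite !FE mul0r sub0r.
    under [X in _ <= - X]eq_bigr do rewrite addr0.
    by apply: max => j; exact: dd.
have := dF _ d0; under eq_bigr do rewrite addr0.
by case: D0 => _ E [_]; rewrite E => /eqP; rewrite eq_sym subr_eq0 => /eqP.
Qed.

End steep_family_theory.

(** * Maximum likelihood and typical tables *)

Section maximum_likelihood.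
Context {R : realType} (mu : {measure set (measurableTypeR R) -> \bar R}).
Context (A e : \bar R) (Psi f g : R -> R).
Hypothesis H : steep_family mu A e Psi f g.
Local Notation dom th := (th%:E < e)%E.

Lemma dual_feasibleP m n (alpha : 'rV[R]_m) (beta : 'rV[R]_n) :
  dual_feasible mu alpha beta <-> forall i j, dom (alpha 0 i + beta 0 j).
Proof.
by split=> d i j; have := d i j; rewrite (steep_dom H).
Qed.

Lemma open_boxP m n (Z : 'M[R]_(m, n)) :
  open_box mu Z <-> forall i j, (A < (Z i j)%:E)%E.
Proof.
rewrite /open_box /= (steep_inf H) (steep_sup H).
by split=> h i j; have := h i j; rewrite ltry andbT.
Qed.

Lemma tables_pairing m n (r : 'rV[R]_m) (c : 'rV[R]_n)
    (Z : 'M[R]_(m, n)) (alpha : 'rV[R]_m) (beta : 'rV[R]_n) :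
  tables r c Z ->
  \sum_i r 0 i * alpha 0 i + \sum_j c 0 j * beta 0 j =
  \sum_i \sum_j Z i j * (alpha 0 i + beta 0 j) :> R.
Proof.
move=> [Zr Zc].
under eq_bigr do rewrite -Zr mulr_suml.
under [X in _ + X]eq_bigr do rewrite -Zc mulr_suml.
rewrite [X in _ + X]exchange_big -big_split; apply: eq_bigr => i _ /=.
by rewrite -big_split; apply: eq_bigr => j _ /=; rewrite mulrDr.
Qed.

Lemma log_likelihoodE m n (r : 'rV[R]_m) (c : 'rV[R]_n)
    (Z : 'M[R]_(m, n)) (alpha : 'rV[R]_m) (beta : 'rV[R]_n) :
  tables r c Z ->
  log_likelihood mu r c alpha beta =
  \sum_i \sum_j (Z i j * (alpha 0 i + beta 0 j) - Psi (alpha 0 i + beta 0 j)).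
Proof.
move=> TZ; rewrite /log_likelihood (steep_psi H) (tables_pairing _ _ TZ).
by rewrite -sumrB; apply: eq_bigr => i _; rewrite -sumrB.
Qed.

Lemma log_likelihood_shift m n (r : 'rV[R]_m) (c : 'rV[R]_n)
    (Z : 'M[R]_(m, n)) (alpha : 'rV[R]_m) (beta : 'rV[R]_n) (x : R) :
  tables r c Z ->
  log_likelihood mu r c (\row_i (alpha 0 i + x)) (\row_j (beta 0 j - x)) =
  log_likelihood mu r c alpha beta.
Proof.
move=> TZ; rewrite !(log_likelihoodE _ _ TZ).
apply: eq_bigr => i _; apply: eq_bigr => j _; rewrite !mxE.
by rewrite (_ : _ + x + _ = alpha 0 i + beta 0 j)//; ring.
Qed.

(** All the [G k l - U] are nonpositive, so their sum is at most any one of them. A lower bound on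
    the likelihood thus becomes a lower bound on each of its terms. *)
Lemma sum_ub_entry m n (G : 'I_m -> 'I_n -> R) U i j :
  (forall k l, G k l <= U) -> \sum_k \sum_l G k l - U *+ (m * n) <= G i j - U.
Proof.
move=> GU; rewrite (_ : U *+ _ = \sum_(k < m) \sum_(l < n) U); last first.
  by rewrite !sumr_const !card_ord -mulrnA mulnC.
rewrite -sumrB (bigD1 i)//= -sumrB (bigD1 j)//= -addrA gerDl.
rewrite -[leRHS](addr0 0); apply: lerD.
  by apply: sumr_le0 => l _; rewrite subr_le0.
apply: sumr_le0 => k _; rewrite -sumrB.
by apply: sumr_le0 => l _; rewrite subr_le0.
Qed.

(** The likelihood is invariant under moving a constant from [beta] to [alpha], so [beta 0 0 = 0]
    may be imposed. The pairs at least as good as a starting point then lie in a compact set inside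
    the domain, where the extreme value theorem applies. *)
Lemma MLE_exists m n (r : 'rV[R]_m.+1) (c : 'rV[R]_n.+1) :
  tables r c `&` open_box mu !=set0 ->
  exists alpha beta, is_MLE mu r c alpha beta.
Proof.
move=> [Z [TZ /open_boxP AZ]].
pose h i j th := Z i j * th - Psi th.
have [U hU] : exists U : R, forall i j th, dom th -> h i j th <= U.
  exists (\big[Num.max/0]_i \big[Num.max/0]_j
    (Z i j * g (Z i j) - Psi (g (Z i j)))) => i j th dth.
  apply: le_trans (steep_ub H (AZ i j) dth) _.
  apply: le_trans (le_bigmax _ _ i).
  exact: (le_bigmax _ (fun j => Z i j * g (Z i j) - Psi (g (Z i j)))).
set th0 := g (Z 0 0); have [dth0 _] := steep_inv H (AZ 0 0).
pose a0 : 'rV[R]_m.+1 := \row__ th0; pose b0 : 'rV[R]_n.+1 := \row__ 0.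
have d0 i j : dom (a0 0 i + b0 0 j) by rewrite !mxE addr0.
pose L := log_likelihood mu r c a0 b0.
pose N := (m.+1 * n.+1)%N.
have hL (alpha : 'rV[R]_m.+1) (beta : 'rV[R]_n.+1) :
    (forall i j, dom (alpha 0 i + beta 0 j)) ->
    L <= log_likelihood mu r c alpha beta ->
    forall i j, L - U *+ N <= h i j (alpha 0 i + beta 0 j) - U.
  move=> dab Lab i j.
  apply: (@le_trans _ _ (log_likelihood mu r c alpha beta - U *+ N)).
    exact: lerB.
  rewrite (log_likelihoodE _ _ TZ).
  apply: (sum_ub_entry (G := fun i j => h i j (alpha 0 i + beta 0 j))).
  by move=> k l; exact: hU.
have [hi [dhi hhi]] : exists hi, dom hi /\ forall i j th, dom th ->
    L - U *+ N <= h i j th - U -> th <= hi.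
  pose hs i j := sval (cid2 (steep_coercive H (L - U *+ N + U) (AZ i j))).
  have dhs i j : dom (hs i j) by rewrite /hs; case: cid2.
  exists (\big[Num.max/th0]_i \big[Num.max/th0]_j hs i j); split.
    have dmax x y : dom x -> dom y -> dom (Num.max x y).
      by rewrite /Num.max; case: ifP.
    by elim/big_ind : _ => // i _; elim/big_ind : _.
  move=> i j th dth; rewrite lerBrDr => hth.
  apply: le_trans (le_bigmax _ _ i).
  apply: le_trans (le_bigmax _ (hs i) j).
  by rewrite /hs; case: cid2 => /= x _; apply.
have [lo hlo] : exists lo, forall i j th, dom th ->
    L - U *+ N <= h i j th - U -> lo <= th.
  pose ls i j := sval (cid (steep_superlevel H (L - U *+ N + U) (AZ i j))).
  exists (\big[Num.min/0]_i \big[Num.min/0]_j ls i j) => i j th dth.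
  rewrite lerBrDr => hth.
  apply: (@le_trans _ _ (\big[Num.min/0]_j ls i j)); first exact: bigmin_le.
  apply: (@le_trans _ _ (ls i j)); first exact: bigmin_le.
  rewrite /ls; case: cid => /= x [y [_ /(_ th dth hth)]].
  by case/andP.
(* With [beta 0 0 = 0], each [alpha i] lies in [[lo, hi]] and
   [beta j = (alpha 0 + beta j) - alpha 0] in [[lo - hi, hi - lo]]. The last constraint keeps all
   sums at most [hi], hence in the domain. *)
pose K : set ('rV[R]_m.+1 * 'rV[R]_n.+1) :=
  ([set u : 'rV[R]_m.+1 | forall i, `[lo, hi]%classic (u ord0 i)] `*`
   [set v : 'rV[R]_n.+1 | forall j, `[lo - hi, hi - lo]%classic (v ord0 j)]) `&`
  \bigcap_(ij in [set: 'I_m.+1 * 'I_n.+1])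
    (fun w : 'rV[R]_m.+1 * 'rV[R]_n.+1 => w.1 0 ij.1 + w.2 0 ij.2) @^-1`
      [set x | x <= hi].
have coordD i j :
    continuous (fun w : 'rV[R]_m.+1 * 'rV[R]_n.+1 => w.1 0 i + w.2 0 j).
  move=> w; apply: cvgD.
    apply: (@continuous_comp _ _ _ fst (fun u : 'rV[R]_m.+1 => u 0 i)).
      exact: cvg_fst.
    exact: coord_continuous.
  apply: (@continuous_comp _ _ _ snd (fun u : 'rV[R]_n.+1 => u 0 j)).
    exact: cvg_snd.
  exact: coord_continuous.
have cK : compact K.
  apply: compact_closedI.
    apply: compact_setX.
      apply: (rV_compact (A := fun=> `[lo, hi]%classic)) => k.
      exact: segment_compact.
    apply: (rV_compact (A := fun=> `[lo - hi, hi - lo]%classic)) => k.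
    exact: segment_compact.
  apply: closed_bigI => -[i j] _; apply: closed_comp; last exact: closed_le.
  by move=> w _; exact: coordD.
have KE (alpha : 'rV[R]_m.+1) (beta : 'rV[R]_n.+1) :
    (forall i j, dom (alpha 0 i + beta 0 j)) ->
    L <= log_likelihood mu r c alpha beta -> beta 0 0 = 0 ->
    K (alpha, beta).
  move=> dab Lab beta0; have hab := hL _ _ dab Lab.
  have ha i : lo <= alpha 0 i <= hi.
    rewrite -[alpha 0 i]addr0 -beta0.
    by rewrite (hlo _ _ _ (dab i 0) (hab i 0)) (hhi _ _ _ (dab i 0) (hab i 0)).
  split; [split|].
  - by move=> i /=; rewrite in_itv/=.
  - move=> j /=; rewrite in_itv/=.
    have := hlo _ _ _ (dab 0 j) (hab 0 j); have := hhi _ _ _ (dab 0 j) (hab 0 j).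
    have := ha 0; lra.
  - by move=> [i j] _ /=; exact: hhi (dab i j) (hab i j).
pose F (w : 'rV[R]_m.+1 * 'rV[R]_n.+1) := log_likelihood mu r c w.1 w.2.
have domK w : K w -> forall i j, dom (w.1 0 i + w.2 0 j).
  move=> [_ Kw] i j; apply: (steep_dom_le _ dhi).
  exact: (Kw (i, j)).
have cF : {within K, continuous F}.
  apply: continuous_in_subspaceT => w; rewrite inE => /domK dw.
  have -> : F = fun w => \sum_i \sum_j h i j (w.1 0 i + w.2 0 j).
    by apply/funext => u; rewrite /F (log_likelihoodE _ _ TZ).
  apply: cvg_big => [|i _]; first exact: add_continuous.
  apply: cvg_big => [|j _]; first exact: add_continuous.
  apply: (cvg_comp (fun w : 'rV[R]_m.+1 * 'rV[R]_n.+1 => w.1 0 i + w.2 0 j) (h i j)).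
    exact: coordD.
  apply: cvgB; last exact: (steep_continuous H).
  by apply: cvgM; [exact: cvg_cst|exact: cvg_id].
have K0 : K (a0, b0) by apply: KE => //; rewrite mxE.
have [[a b] + maxF] := compact_EVT_max (ex_intro _ _ K0) cK cF.
rewrite inE => /domK /= dab.
exists a, b; split; first exact/dual_feasibleP.
move=> alpha beta /dual_feasibleP dal.
(* A competitor below the level [L] loses to the starting point, which belongs to [K]; any other is
   normalized by a shift and then lies in [K]. *)
have /orP[Lab|] := le_total L (log_likelihood mu r c alpha beta); last first.
  move=> /le_trans; apply.
  by have := maxF (a0, b0); rewrite inE; apply.
rewrite -(log_likelihood_shift alpha beta (beta 0 0) TZ) in Lab *.
have := maxF (\row_i (alpha 0 i + beta 0 0), \row_j (beta 0 j - beta 0 0)).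
rewrite inE; apply; apply: KE => //; last by rewrite mxE subrr.
move=> i j; rewrite !mxE.
by rewrite (_ : _ + _ + _ = alpha 0 i + beta 0 j)//; ring.
Qed.

(** Moving a single [alpha i] changes only the terms of row [i], so stationarity gives that row sum;
    columns are symmetric. *)
Lemma MLE_tables m n (r : 'rV[R]_m) (c : 'rV[R]_n)
    (alpha : 'rV[R]_m) (beta : 'rV[R]_n) :
  is_MLE mu r c alpha beta ->
  tables r c (\matrix_(i, j) f (alpha 0 i + beta 0 j)).
Proof.
move=> [/dual_feasibleP dab max]; split => [i|j].
- under eq_bigr do rewrite mxE.
  apply: (steep_stationary H) => [j|t dt]; first exact: dab.
  pose al : 'rV[R]_m := \row_k (alpha 0 k + if k == i then t else 0).
  have := max al beta.
  have dal : dual_feasible mu al beta.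
    apply/dual_feasibleP => k j; rewrite mxE; case: eqP => [->|_].
      by rewrite addrAC.
    by rewrite addr0.
  move=> /(_ dal); rewrite /log_likelihood (steep_psi H).
  rewrite [X in X + _ - _ <= _](bigD1 i)//= [X in _ - X <= _](bigD1 i)//=.
  rewrite [X in _ <= X + _ - _](bigD1 i)//= [X in _ <= _ - X](bigD1 i)//=.
  rewrite mxE eqxx.
  have -> : \sum_(k < m | k != i) r 0 k * al 0 k =
      \sum_(k < m | k != i) r 0 k * alpha 0 k.
    by apply: eq_bigr => k /negbTE ki; rewrite mxE ki addr0.
  have -> : \sum_(k < m | k != i) \sum_j Psi (al 0 k + beta 0 j) =
      \sum_(k < m | k != i) \sum_j Psi (alpha 0 k + beta 0 j).
    apply: eq_bigr => k /negbTE ki; apply: eq_bigr => j _.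
    by rewrite mxE ki addr0.
  under [X in _ - (X + _) <= _]eq_bigr do rewrite addrAC.
  lra.
- under eq_bigr do rewrite mxE.
  apply: (steep_stationary H) => [i|t dt]; first exact: dab.
  pose be : 'rV[R]_n := \row_k (beta 0 k + if k == j then t else 0).
  have := max alpha be.
  have dbe : dual_feasible mu alpha be.
    apply/dual_feasibleP => i k; rewrite mxE; case: eqP => [->|_].
      by rewrite addrA.
    by rewrite addr0.
  move=> /(_ dbe); rewrite /log_likelihood (steep_psi H).
  rewrite [X in _ - X <= _]exchange_big [X in _ <= _ - X]exchange_big/=.
  rewrite [X in _ + X - _ <= _](bigD1 j)//= [X in _ - X <= _](bigD1 j)//=.
  rewrite [X in _ <= _ + X - _](bigD1 j)//= [X in _ <= _ - X](bigD1 j)//=.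
  rewrite mxE eqxx.
  have -> : \sum_(k < n | k != j) c 0 k * be 0 k =
      \sum_(k < n | k != j) c 0 k * beta 0 k.
    by apply: eq_bigr => k /negbTE ki; rewrite mxE ki addr0.
  have -> : \sum_(k < n | k != j) \sum_i Psi (alpha 0 i + be 0 k) =
      \sum_(k < n | k != j) \sum_i Psi (alpha 0 i + beta 0 k).
    apply: eq_bigr => k /negbTE ki; apply: eq_bigr => i _.
    by rewrite mxE ki addr0.
  under [X in _ - (X + _) <= _]eq_bigr do rewrite addrA.
  lra.
Qed.

Lemma table_energyE m n (Z : 'M[R]_(m, n)) : open_box mu Z ->
  table_energy mu Z = \sum_i \sum_j (Z i j * g (Z i j) - Psi (g (Z i j))).
Proof.
move=> /open_boxP AZ; rewrite /table_energy (steep_psi H).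
by do 2 (apply: eq_bigr => ? _); rewrite (steep_phi H).
Qed.

Lemma ltr_sum2 m n (F G : 'I_m -> 'I_n -> R) i j :
  (forall k l, F k l <= G k l) -> F i j < G i j ->
  \sum_k \sum_l F k l < \sum_k \sum_l G k l.
Proof.
move=> FG ij; rewrite (bigD1 i)//= [X in _ < X](bigD1 i)//=.
apply: ltr_leD; last by apply: ler_sum => k _; exact: ler_sum.
rewrite (bigD1 j)//= [X in _ < X](bigD1 j)//=.
by apply: ltr_leD => //; exact: ler_sum.
Qed.

(** Duality: each energy term of [Z'] is the maximum over [th] of [Z' i j * th - Psi th], so it
    dominates the value at [alpha i + beta j], strictly where [Z'] differs from [Z]. *)
Lemma MLE_typical_table m n (r : 'rV[R]_m) (c : 'rV[R]_n)
    (alpha : 'rV[R]_m) (beta : 'rV[R]_n) :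
  is_MLE mu r c alpha beta ->
  is_typical_table mu r c (\matrix_(i, j) f (alpha 0 i + beta 0 j)).
Proof.
move=> ML; have TZ := MLE_tables ML; have [/dual_feasibleP dab _] := ML.
set Z := \matrix_(i, j) _ in TZ *.
have oZ : open_box mu Z.
  by apply/open_boxP => i j; rewrite mxE; exact: (steep_range H).
split => // Z' [TZ' oZ'] Z'Z; have /open_boxP AZ' := oZ'.
(* The pairing of a table with [alpha i + beta j] depends only on its margins, so [Z] may be
   replaced by [Z'] there. *)
have -> : table_energy mu Z = \sum_i \sum_j
    (Z' i j * (alpha 0 i + beta 0 j) - Psi (alpha 0 i + beta 0 j)).
  rewrite -(log_likelihoodE _ _ TZ') (log_likelihoodE _ _ TZ) table_energyE//.
  by do 2 (apply: eq_bigr => ? _); rewrite mxE (steep_invK H).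
have [i [j ij]] : exists i j, Z' i j != Z i j.
  apply: contrapT => h; move/eqP: Z'Z; apply; apply/matrixP => i j.
  by apply/eqP/negPn/negP => ij; apply: h; exists i, j.
rewrite table_energyE//; apply: (@ltr_sum2 _ _ _ _ i j) => [k l|].
  exact: (steep_ub H).
have [dg fg] := steep_inv H (AZ' i j).
have ne : alpha 0 i + beta 0 j != g (Z' i j).
  by apply: contra_neq ij => E; rewrite mxE E fg.
have := steep_tangent_lt H (dab i j) dg ne; rewrite fg; lra.
Qed.

End maximum_likelihood.

(** * Bounds on the largest entry *)

Section entry_bounds.
Context {R : realType}.
Implicit Types (s t w c k : R).

Lemma sum_concave_le n c t (q : 'I_n -> R) : 0 < c -> 0 < t ->
  (forall j, 0 < q j) -> \sum_j q j <= t * n%:R ->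
  \sum_j q j / (c + q j) <= t / (c + t) * n%:R.
Proof.
move=> c0 t0 q0 qt.
(* The concave function [x / (c + x)] lies below its tangent at [t]. The slope is positive, so the
   upper bound on the sum of the [q j] suffices. *)
have tangent x : 0 < x -> x / (c + x) <= t / (c + t) + c / (c + t) ^+ 2 * (x - t).
  move=> x0; rewrite -subr_ge0.
  rewrite (_ : _ - _ = c * (x - t) ^+ 2 / ((c + t) ^+ 2 * (c + x))); last first.
    by field; apply/andP; split; rewrite gt_eqF// addr_gt0.
  by apply: divr_ge0; apply: mulr_ge0; rewrite ?sqr_ge0 ?addr_ge0// ltW.
apply: (@le_trans _ _ (\sum_j (t / (c + t) + c / (c + t) ^+ 2 * (q j - t)))).
  by apply: ler_sum => j _; exact: tangent.
rewrite big_split/= sumr_const card_ord -[_ / _ *+ n]mulr_natr gerDl -mulr_sumr.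
rewrite mulr_ge0_le0 ?divr_ge0 ?exprn_ge0 ?addr_ge0 ?(ltW c0) ?(ltW t0)//.
by rewrite sumrB sumr_const card_ord -[t *+ n]mulr_natr subr_le0.
Qed.

Section table.
Context (m n : nat) (s t w : R).
Context (p : 'I_m.+1 -> R) (q : 'I_n.+1 -> R) (z : 'I_m.+1 -> 'I_n.+1 -> R).
Hypothesis pt : \sum_i p i <= t * m.+1%:R.
Hypothesis qt : \sum_j q j <= t * n.+1%:R.
Hypothesis zs : forall i, s * n.+1%:R <= \sum_j z i j.

Let m0 : 0 < m.+1%:R :> R. Proof. by []. Qed.
Let n0 : 0 < n.+1%:R :> R. Proof. by []. Qed.

Let sum_z : s * n.+1%:R * m.+1%:R <= \sum_i \sum_j z i j.
Proof.
rewrite (_ : _ * m.+1%:R = \sum_(i < m.+1) s * n.+1%:R); last first.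
  by rewrite sumr_const card_ord mulr_natr.
by apply: ler_sum => i _; exact: zs.
Qed.

Let sum_pq : (forall i, 0 < p i) -> (forall j, 0 < q j) -> 0 < t ->
  (\sum_i p i) * (\sum_j q j) <= t ^+ 2 * (n.+1%:R * m.+1%:R).
Proof.
move=> p0 q0 t0.
rewrite (_ : t ^+ 2 * _ = t * m.+1%:R * (t * n.+1%:R)); last by ring.
by apply: ler_pM => //; apply: sumr_ge0 => ? _; exact: ltW.
Qed.

(** Here [p] and [q] are the column and the row through the entry [w]. Since [z <= p + q], the
    relation bounds [z] by [p q / (k + p + q) + p q / w], and the first term is averaged over [q],
    then over [p], by concavity. *)
Lemma kappa_entry_le k : 0 <= k -> 0 < t -> 0 < w ->
  (forall i, 0 < p i) -> (forall j, 0 < q j) ->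
  (forall i j, z i j <= p i) ->
  (forall i j, z i j * w * (k + p i + q j) = p i * q j * (k + z i j + w)) ->
  t ^+ 2 / (k + 2 * t) < s ->
  w <= t ^+ 2 / (s - t ^+ 2 / (k + 2 * t)).
Proof.
move=> k0 t0 w0 p0 q0 zp rel hs.
have z_le i j : z i j <= p i * (q j / (k + p i + q j)) + p i * q j / w.
  have S0 : 0 < k + p i + q j by rewrite addr_gt0// ltr_wpDl.
  rewrite (_ : _ + _ =
    p i * q j * (k + p i + q j + w) / ((k + p i + q j) * w)); last first.
    by field; rewrite !gt_eqF.
  rewrite ler_pdivlMr ?mulr_gt0// [_ * w]mulrC mulrA rel.
  rewrite ler_pM2l ?mulr_gt0// lerD2r.
  have := zp i j; have := q0 j; lra.
have S1 i : \sum_j z i j <=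
    t * (p i / (k + t + p i)) * n.+1%:R + p i * (\sum_j q j) / w.
  apply: (le_trans (ler_sum _ (fun j _ => z_le i j))).
  rewrite big_split/= -mulr_sumr -mulr_suml -mulr_sumr lerD2r.
  have kp : 0 < k + p i by rewrite ltr_wpDl.
  have := sum_concave_le kp t0 q0 qt; rewrite -(ler_pM2l (p0 i)).
  move=> /le_trans; apply.
  by rewrite (_ : k + p i + t = k + t + p i); [lra|ring].
have S2 : \sum_i \sum_j z i j <=
    (t ^+ 2 / (k + 2 * t) + t ^+ 2 / w) * (n.+1%:R * m.+1%:R).
  apply: (le_trans (ler_sum _ (fun i _ => S1 i))).
  rewrite big_split/= -!mulr_suml -mulr_sumr mulrDl; apply: lerD.
    have kt : 0 < k + t by rewrite ltr_wpDl.
    have := ler_wpM2l (ltW t0) (sum_concave_le kt t0 p0 pt).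
    move=> /(ler_wpM2r (ltW n0)) /le_trans; apply.
    rewrite (_ : k + t + t = k + 2 * t); last by ring.
    by rewrite le_eqVlt; apply/orP; left; apply/eqP; ring.
  by rewrite [leRHS]mulrAC ler_pM2r ?invr_gt0//; exact: sum_pq.
have := le_trans sum_z S2; rewrite -mulrA ler_pM2r ?mulr_gt0// => h.
rewrite ler_pdivlMr ?subr_gt0// mulrC -ler_pdivlMr//; lra.
Qed.

(** Summing the relation over all entries factors the right side into the product of the two
    sums. *)
Lemma product_entry_le : 0 < s -> 0 < t -> 0 < w ->
  (forall i, 0 < p i) -> (forall j, 0 < q j) ->
  (forall i j, z i j * w = p i * q j) -> w <= t ^+ 2 / s.
Proof.
move=> s0 t0 w0 p0 q0 rel.
have S : (\sum_i \sum_j z i j) * w = (\sum_i p i) * (\sum_j q j).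
  rewrite mulr_suml mulr_suml; apply: eq_bigr => i _.
  by rewrite mulr_suml mulr_sumr; apply: eq_bigr.
have := sum_pq p0 q0 t0; rewrite -S.
move: sum_z; rewrite -(ler_pM2r w0) => h1 h2.
have := le_trans h1 h2; rewrite ler_pdivlMr//.
rewrite (_ : s * _ * _ * w = w * s * (n.+1%:R * m.+1%:R)); last by ring.
by rewrite ler_pM2r ?mulr_gt0.
Qed.

Lemma sum_entry_le : (forall i j, z i j + w = p i + q j) -> w <= 2 * t - s.
Proof.
move=> rel.
have S : \sum_i \sum_j z i j =
    n.+1%:R * (\sum_i p i) + m.+1%:R * (\sum_j q j) - w * (n.+1%:R * m.+1%:R).
  rewrite (eq_bigr (fun i => n.+1%:R * p i + (\sum_j q j - w * n.+1%:R))).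
    rewrite big_split/= -mulr_sumr sumr_const card_ord -mulr_natr; ring.
  move=> i _; rewrite (eq_bigr (fun j => p i + (q j - w))).
    rewrite big_split sumrB/= !sumr_const card_ord.
    by rewrite -[p i *+ _]mulr_natr -[w *+ _]mulr_natr; ring.
  by move=> j _; rewrite addrA -rel addrK.
have := sum_z; rewrite S => h; rewrite -(ler_pM2r (mulr_gt0 n0 m0)).
have := ler_wpM2l (ltW n0) pt; have := ler_wpM2l (ltW m0) qt; move: h.
by move: (\sum_i p i) (\sum_j q j) (n.+1%:R) (m.+1%:R) => P Q N M; lra.
Qed.

End table.
End entry_bounds.

(** * From a uniform entry bound to tameness *)

Section tameness.
Context {R : realType} (mu : {measure set (measurableTypeR R) -> \bar R}).
Context (A e : \bar R) (Psi f g : R -> R).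
Hypothesis H : steep_family mu A e Psi f g.
Local Notation dom th := (th%:E < e)%E.

Lemma sum_ge_exists n (F : 'I_n.+1 -> R) x :
  x * n.+1%:R <= \sum_j F j -> exists j, x <= F j.
Proof.
move=> xF; apply/not_existsP => h; move: xF; apply/negP; rewrite -ltNge.
rewrite (_ : x * _ = \sum_(j < n.+1) x); last first.
  by rewrite sumr_const card_ord mulr_natr.
rewrite big_ord_recl [ltRHS]big_ord_recl/=; apply: ltr_leD.
  by rewrite ltNge; apply/negP.
by apply: ler_sum => j _; rewrite leNgt; apply/negP => /ltW; exact: h.
Qed.

(* If entries (i, j') and (i', j) are at least [s] and entry (i', j') is at
   most [W], the natural parameter at (i, j) is at least [2 g s - g W]. *)
Lemma steep_tame (s t W : R) : (A < s%:E)%E -> s <= W ->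
  (forall m n (a : 'I_m.+1 -> R) (b : 'I_n.+1 -> R),
    (forall i j, dom (a i + b j)) ->
    (forall i, s * n.+1%:R <= \sum_j f (a i + b j) <= t * n.+1%:R) ->
    (forall j, s * m.+1%:R <= \sum_i f (a i + b j) <= t * m.+1%:R) ->
    forall i j, f (a i + b j) <= W) ->
  exists2 delta : R, 0 < delta &
    forall m n : nat, (0 < m)%N -> (0 < n)%N ->
    forall (r : 'rV[R]_m) (c : 'rV[R]_n),
      bounded_margin mu s t r c -> tame mu delta r c.
Proof.
move=> As sW bound.
have AW : (A < W%:E)%E by apply: lt_le_trans As _; rewrite lee_fin.
have [dgs fgs] := steep_inv H As; have [dgW fgW] := steep_inv H AW.
have gsW : g s <= g W by rewrite -(steep_le_mono H dgs dgW) fgs fgW.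
set th := 2 * g s - g W.
have dth : dom th by apply: steep_dom_le dgs; rewrite /th; lra.
(* For finite [A] this is the gap between [A] and the least possible entry [f th]; for [A = -oo] any
   positive number serves. *)
have [d1 d10 Ad1] : exists2 d, 0 < d & (A + d%:E <= (f th)%:E)%E.
  have := steep_range H dth; case: (A) => [a| |]//=.
    rewrite lte_fin => af; exists (f th - a); first by rewrite subr_gt0.
    by rewrite -EFinD lee_fin addrC subrK.
  by move=> _; exists 1; rewrite //= leNye.
pose d2 := (1 + `|f th| + `|W|)^-1.
have d2p : 0 < 1 + `|f th| + `|W| by rewrite -addrA ltr_pwDl// addr_ge0.
have d20 : 0 < d2 by rewrite invr_gt0.
exists (Num.min d1 d2); first by rewrite lt_min d10.
have dV : 1 + `|f th| + `|W| <= (Num.min d1 d2)^-1.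
  rewrite -[leLHS]invrK lef_pV2 ?posrE ?lt_min ?d10//.
  by rewrite ge_min lexx orbT.
move=> [//|m] [//|n] _ _ r c [ne rb cb].
have [alpha [beta ML]] := MLE_exists H ne.
have [Tr Tc] := MLE_tables H ML.
have [/(dual_feasibleP H) dab _] := ML.
pose a := alpha 0; pose b := beta 0.
have sr i : s * n.+1%:R <= \sum_j f (a i + b j) <= t * n.+1%:R.
  have := Tr i; under eq_bigr do rewrite mxE; move=> ->.
  by have := rb i; rewrite ler_pdivlMr// ler_pdivrMr.
have sc j : s * m.+1%:R <= \sum_i f (a i + b j) <= t * m.+1%:R.
  have := Tc j; under eq_bigr do rewrite mxE; move=> ->.
  by have := cb j; rewrite ler_pdivlMr// ler_pdivrMr.
have ub := bound _ _ a b dab sr sc.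
exists alpha, beta; split => // i j; rewrite (steep_derive1 H)//.
have lb : f th <= f (alpha 0 i + beta 0 j).
  rewrite (steep_le_mono H)//.
  (* The row of [i] and the column of [j] each contain an entry at least their average, and [a i + b
     j = (a i + b j') + (a i' + b j) - (a i' + b j')]. *)
  have [j' sj'] := sum_ge_exists (proj1 (andP (sr i))).
  have [i' si'] := sum_ge_exists (proj1 (andP (sc j))).
  have := ub i' j'; move: sj' si'; rewrite -fgs -fgW !(steep_le_mono H)//.
  rewrite /th /a /b; lra.
apply/andP; split.
- rewrite /A_ (steep_inf H) ge_max; apply/andP; split.
    apply: (@le_trans _ _ (f th)%:E); last by rewrite lee_fin.
    by apply: le_trans Ad1; apply: leeD => //; rewrite lee_fin ge_min lexx.
  rewrite lee_fin; apply: le_trans lb.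
  rewrite lerNl; apply: le_trans dV; have := ler_norm (- f th).
  have := normr_ge0 W; rewrite normrN; lra.
- rewrite /B_ (steep_sup H) addye// le_min leey/= lee_fin.
  apply: (le_trans (ub i j)); apply: le_trans dV.
  have := ler_norm W; have := normr_ge0 (f th); lra.
Qed.

End tameness.

Lemma ord_max_exists {R : realType} n (a : 'I_n.+1 -> R) :
  exists i, forall j, a j <= a i.
Proof.
case: (@Order.TotalTheory.arg_maxP _ _ _ ord0 predT a) => // i _ h.
by exists i => j; exact: h.
Qed.

Section maximal_entry.
Context {R : realType} (mu : {measure set (measurableTypeR R) -> \bar R}).
Context (A e : \bar R) (Psi f g : R -> R).
Hypothesis H : steep_family mu A e Psi f g.
Local Notation dom th := (th%:E < e)%E.

(** As [f] is increasing, the largest entry sits at the maxima [i0] of [a] and [j0] of [b], and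
    column [j0] dominates every row; only that entry has to be bounded. *)
Lemma maximal_entry_le (s t W : R) :
  (forall m n (a : 'I_m.+1 -> R) (b : 'I_n.+1 -> R) i0 j0,
    (forall i j, dom (a i + b j)) ->
    (forall i, s * n.+1%:R <= \sum_j f (a i + b j)) ->
    \sum_j f (a i0 + b j) <= t * n.+1%:R ->
    \sum_i f (a i + b j0) <= t * m.+1%:R ->
    (forall i j, f (a i + b j) <= f (a i + b j0)) ->
    f (a i0 + b j0) <= W) ->
  forall m n (a : 'I_m.+1 -> R) (b : 'I_n.+1 -> R),
    (forall i j, dom (a i + b j)) ->
    (forall i, s * n.+1%:R <= \sum_j f (a i + b j) <= t * n.+1%:R) ->
    (forall j, s * m.+1%:R <= \sum_i f (a i + b j) <= t * m.+1%:R) ->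
    forall i j, f (a i + b j) <= W.
Proof.
move=> h m n a b dab sr sc i j.
have [i0 ai0] := ord_max_exists a; have [j0 bj0] := ord_max_exists b.
apply: (@le_trans _ _ (f (a i0 + b j0))).
  by rewrite (steep_le_mono H)//; exact: lerD.
apply: (h m n) => //.
- by move=> k; case/andP: (sr k).
- by case/andP: (sr i0).
- by case/andP: (sc j0).
- by move=> k l; rewrite (steep_le_mono H)// lerD2l.
Qed.

End maximal_entry.

(** * Divergence above the critical ratio *)

(** The two equations are row sums divided by the number [1 / x] of ordinary columns. If [w < K],
    then [p] is near [t] and [z] is at most about [s], while the relation forces
    [p ^+ 2 < z * (k + 2 * p)]; the last hypothesis makes [x] small enough to contradict this. *)
Lemma corner_entry_large {R : realType} (k s t K w p z x : R) :
  0 <= k -> 0 < s -> 0 < t -> 0 < K -> 0 < x -> x <= 1 ->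
  0 < w -> 0 < p -> 0 < z ->
  w * x + p = t * (1 + x) -> p * x + z = s * (1 + x) ->
  z * w * (k + p + p) = p * p * (k + z + w) ->
  x * (2 * t * K + s * (k + 2 * t) + 4 * s * t) <= t ^+ 2 - s * (k + 2 * t) ->
  K <= w.
Proof.
move=> k0 s0 t0 K0 x0 x1 w0 p0 z0 Ep Ez rel hx; rewrite leNgt; apply/negP => wK.
have zp : p ^+ 2 < z * (k + 2 * p).
  rewrite -(ltr_pM2r w0).
  have -> : z * (k + 2 * p) * w = p * p * (k + z + w) by rewrite -rel; ring.
  rewrite (_ : p * p * _ = p ^+ 2 * w + p ^+ 2 * (k + z)); last by ring.
  by rewrite ltrDl mulr_gt0 ?exprn_gt0// ltr_wpDl.
have p_ge : t - K * x <= p.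
  have : w * x < K * x by rewrite ltr_pM2r.
  have : 0 < t * x by rewrite mulr_gt0.
  lra.
have p_le : p <= t + t * x by have := mulr_gt0 w0 x0; lra.
have z_le : z <= s * (1 + x) by have := mulr_gt0 p0 x0; lra.
have h1 : t ^+ 2 - 2 * t * K * x <= p ^+ 2.
  have := sqr_ge0 (p - t).
  have : t * (t - K * x) <= t * p by rewrite ler_pM2l.
  lra.
have h2 : z * (k + 2 * p) <= s * (1 + x) * (k + 2 * (t + t * x)).
  apply: ler_pM => //; [exact: ltW|by rewrite addr_ge0// mulr_ge0// ltW|lra].
have h3 : s * t * x ^+ 2 <= s * t * x.
  by rewrite ler_pM2l ?mulr_gt0// expr2 ler_piMr// ltW.
lra.
Qed.

Section divergence.
Context {R : realType} (mu : {measure set (measurableTypeR R) -> \bar R}).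
Context (e : \bar R) (Psi f g : R -> R).
Hypothesis H : steep_family mu 0%E e Psi f g.
Local Notation dom th := (th%:E < e)%E.

Lemma row_sum_inj n (b : 'I_n.+1 -> R) (x y : R) :
  (forall j, dom (x + b j)) -> (forall j, dom (y + b j)) ->
  \sum_j f (x + b j) = \sum_j f (y + b j) -> x = y.
Proof.
have sum_lt u v : (forall j, dom (v + b j)) -> u < v ->
    \sum_j f (u + b j) < \sum_j f (v + b j).
  move=> dv uv; have lt j : f (u + b j) < f (v + b j).
    by apply: (steep_incr H) => //; rewrite ltrD2r.
  rewrite big_ord_recl [ltRHS]big_ord_recl/=; apply: ltr_leD => //.
  by apply: ler_sum => j _; exact: ltW.
move=> dx dy E; apply/eqP; rewrite eq_le !leNgt; apply/andP; split.
  by apply/negP => /(sum_lt _ _ dx); rewrite E ltxx.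
by apply/negP => /(sum_lt _ _ dy); rewrite E ltxx.
Qed.

Definition spiked_margin (s t : R) n : 'rV[R]_n.+1 :=
  \row_i ((if i == ord0 then t else s) * n.+1%:R).

Lemma spiked_margin_bounded (s t : R) n : 0 < s -> s < t ->
  bounded_margin mu s t (spiked_margin s t n) (spiked_margin s t n).
Proof.
move=> s0 st; set r := spiked_margin s t n.
have t0 := lt_trans s0 st.
have r0 i : 0 < r 0 i by rewrite mxE mulr_gt0//; case: ifP.
have T0 : 0 < \sum_i r 0 i.
  by rewrite big_ord_recl ltr_pwDl// sumr_ge0// => i _; exact: ltW.
have rn i : s <= r 0 i / n.+1%:R <= t.
  by rewrite mxE mulfK//; case: ifP => _; rewrite lexx ltW.
(* The rank-one independence table is positive and has the prescribed margins. *)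
split => //; exists (\matrix_(i, j) (r 0 i * r 0 j / \sum_i r 0 i)); split.
  split => i.
    under eq_bigr do rewrite mxE.
    by rewrite -mulr_suml -mulr_sumr mulfK// gt_eqF.
  under eq_bigr do rewrite mxE.
  by rewrite -mulr_suml -mulr_suml mulrAC divff ?mul1r// gt_eqF.
by apply/(open_boxP H) => i j; rewrite mxE lte_fin divr_gt0// mulr_gt0.
Qed.

(** Equal row sums force equal row parameters, and likewise for columns, so the fitted table has a
    corner value, a value along the first row, one along the first column and one for the rest. The
    size is [n.+2], leaving [n.+1] ordinary rows and columns. *)
Lemma spiked_corner_large (k s t K : R) n : 0 <= k -> 0 < s -> s < t -> 0 < K ->
  (forall a0 a1 b0 b1, dom (a0 + b0) -> dom (a1 + b0) -> dom (a0 + b1) ->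
    dom (a1 + b1) ->
    f (a1 + b1) * f (a0 + b0) * (k + f (a1 + b0) + f (a0 + b1)) =
    f (a1 + b0) * f (a0 + b1) * (k + f (a1 + b1) + f (a0 + b0))) ->
  2 * t * K + s * (k + 2 * t) + 4 * s * t <=
    (t ^+ 2 - s * (k + 2 * t)) * n.+1%:R ->
  forall alpha beta,
  is_MLE mu (spiked_margin s t n.+1) (spiked_margin s t n.+1) alpha beta ->
  K <= f (alpha 0 ord0 + beta 0 ord0).
Proof.
move=> k0 s0 st K0 rel hn alpha beta ML.
have t0 := lt_trans s0 st.
have [/(dual_feasibleP H) dab _] := ML.
have [Tr Tc] := MLE_tables H ML.
pose i1 : 'I_n.+2 := lift ord0 ord0.
have {}Tr i : \sum_j f (alpha 0 i + beta 0 j) = spiked_margin s t n.+1 0 i.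
  by rewrite -Tr; apply: eq_bigr => j _; rewrite mxE.
have {}Tc j : \sum_i f (alpha 0 i + beta 0 j) = spiked_margin s t n.+1 0 j.
  by rewrite -Tc; apply: eq_bigr => i _; rewrite mxE.
have aE i : alpha 0 (lift ord0 i) = alpha 0 i1.
  by apply: (row_sum_inj (b := beta 0)) => [j|j|]; rewrite ?dab// !Tr !mxE.
have bE j : beta 0 (lift ord0 j) = beta 0 i1.
  apply: (row_sum_inj (b := alpha 0)) => [i|i|].
  - by rewrite addrC.
  - by rewrite addrC.
  - under eq_bigr do rewrite addrC.
    under [RHS]eq_bigr do rewrite addrC.
    by rewrite !Tc !mxE.
set a0 := alpha 0 ord0; set b0 := beta 0 ord0.
set a1 := alpha 0 i1; set b1 := beta 0 i1.
have n0 : 0 < n.+1%:R :> R by [].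
have row a : \sum_j f (a + beta 0 j) = f (a + b0) + f (a + b1) * n.+1%:R.
  rewrite big_ord_recl; congr (_ + _).
  under eq_bigr do rewrite bE.
  by rewrite sumr_const card_ord mulr_natr.
have col b : \sum_i f (alpha 0 i + b) = f (a0 + b) + f (a1 + b) * n.+1%:R.
  rewrite big_ord_recl; congr (_ + _).
  under eq_bigr do rewrite aE.
  by rewrite sumr_const card_ord mulr_natr.
have := Tr ord0; rewrite row mxE eqxx -/a0 => E0.
have := Tr i1; rewrite row mxE /= -/a1 => E1.
have := Tc ord0; rewrite col mxE eqxx -/b0 => F0.
(* The first row and the first column share the corner and have the same sum. *)
have pq : f (a1 + b0) = f (a0 + b1).
  by apply: (mulIf (lt0r_neq0 n0)); lra.
have pos th : dom th -> 0 < f th.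
  by move=> dth; have := steep_range H dth; rewrite lte_fin.
have n2 : n.+2%:R = 1 + n.+1%:R :> R by rewrite -natr1 addrC.
rewrite n2 in E0 E1 F0.
apply: (@corner_entry_large _ k s t K _ (f (a1 + b0)) (f (a1 + b1)) n.+1%:R^-1) => //.
- by rewrite invf_le1// ler1n.
- exact/pos/dab.
- exact/pos/dab.
- exact/pos/dab.
- apply: (mulIf (lt0r_neq0 n0)); rewrite -[RHS]mulrA mulrDl mulfVK ?lt0r_neq0//.
  by rewrite mulrDl mul1r mulVf ?lt0r_neq0// [n.+1%:R + 1]addrC -E0 pq.
- apply: (mulIf (lt0r_neq0 n0)); rewrite -[RHS]mulrA mulrDl mulfVK ?lt0r_neq0//.
  by rewrite mulrDl mul1r mulVf ?lt0r_neq0// [n.+1%:R + 1]addrC -E1.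
- have := rel a0 a1 b0 b1 (dab _ _) (dab _ _) (dab _ _) (dab _ _).
  by rewrite -pq.
- by rewrite mulrC ler_pdivrMr.
Qed.

Lemma steep_diverge (k s t : R) : 0 <= k -> 0 < s -> s < t ->
  s * (k + 2 * t) < t ^+ 2 ->
  (forall a0 a1 b0 b1, dom (a0 + b0) -> dom (a1 + b0) -> dom (a0 + b1) ->
    dom (a1 + b1) ->
    f (a1 + b1) * f (a0 + b0) * (k + f (a1 + b0) + f (a0 + b1)) =
    f (a1 + b0) * f (a0 + b1) * (k + f (a1 + b1) + f (a0 + b0))) ->
  exists (r c : forall n : nat, 'rV[R]_n.+1),
    (forall n, bounded_margin mu s t (r n) (c n)) /\
    exists Z : forall n : nat, 'M[R]_n.+1,
      (forall n, is_typical_table mu (r n) (c n) (Z n)) /\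
      exists i j : forall n : nat, 'I_n.+1,
        Z n (i n) (j n) @[n --> \oo] --> +oo.
Proof.
move=> k0 s0 st kst rel.
pose r := spiked_margin s t.
have br n : bounded_margin mu s t (r n) (r n) by exact: spiked_margin_bounded.
have ML n : exists ab : 'rV[R]_n.+1 * 'rV[R]_n.+1, is_MLE mu (r n) (r n) ab.1 ab.2.
  have [ne _ _] := br n; have [a [b ?]] := MLE_exists H ne.
  by exists (a, b).
pose ab n := sval (cid (ML n)); have abP n := svalP (cid (ML n)).
exists r, r; split => //.
exists (fun n => \matrix_(i, j) f ((ab n).1 0 i + (ab n).2 0 j)); split.
  by move=> n; exact: (MLE_typical_table H).
exists (fun=> ord0), (fun=> ord0).
apply/cvgryPge => K0.
pose K := Num.max K0 1; have K1 : 0 < K by rewrite lt_max ltr01 orbT.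
pose C := 2 * t * K + s * (k + 2 * t) + 4 * s * t.
pose D := t ^+ 2 - s * (k + 2 * t); have D0 : 0 < D by rewrite subr_gt0.
(* Past this index the size beats the ratio [C / D] required by the corner bound; index 0, a
   one-by-one table, is excluded. *)
exists (Num.truncn (C / D)).+1 => // -[//|n] /= Cn; rewrite mxE.
apply: (@le_trans _ _ K); first by rewrite le_max lexx.
apply: (@spiked_corner_large k s t) => //.
rewrite -/C -/D mulrC -ler_pdivrMr//; apply: ltW.
by apply: (lt_le_trans (truncnS_gt _)); rewrite ler_nat.
Qed.

End divergence.

(** * The four families *)

Section builders.
Context {R : realType} (mu : {measure set (measurableTypeR R) -> \bar R}).

Lemma open_lt_ereal (e : \bar R) : open [set th : R | (th%:E < e)%E].
Proof.
case: e => [x| |].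
- by under eq_set do rewrite lte_fin; exact: open_lt.
- rewrite (_ : [set _ | _] = setT); first exact: openT.
  by apply/seteqP; split => // x _ /=; exact: ltry.
- rewrite (_ : [set _ | _] = set0); first exact: open0.
  by apply/seteqP; split => // x /=; rewrite ltNge leNye.
Qed.

Lemma Theta_interior (e : \bar R) :
  (forall th, (laplace mu th < +oo)%E = (th%:E < e)%E) ->
  (Theta mu)° = [set th | (th%:E < e)%E].
Proof.
move=> h; rewrite (_ : Theta mu = [set th | (th%:E < e)%E]).
  exact/interior_id/open_lt_ereal.
by apply/seteqP; split => th /=; rewrite /Theta/= h.
Qed.

(** The closed form of the transform holds on an open set, and differentiation is local. *)
Lemma psi_is_derive (e : \bar R) (F f : R -> R) :
  (forall th, (th%:E < e)%E -> laplace mu th = (expR (F th))%:E) ->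
  (forall th, (th%:E < e)%E -> is_derive th 1 F (f th)) ->
  forall th, (th%:E < e)%E -> is_derive th 1 (psi mu) (f th).
Proof.
move=> FE dF th dth; apply: near_eq_is_derive (dF _ dth).
have : nbhs th [set th | (th%:E < e)%E].
  by apply: open_nbhs_nbhs; split => //; exact: open_lt_ereal.
by apply: filterS => x /FE Ex; rewrite /psi Ex/= expRK.
Qed.

End builders.

Section atomic_support.
Context {R : realType} (w : nat -> {nonneg R}).
Hypothesis w0 : forall k, 0 < (w k)%:num.

Lemma supp_inf_atomic : supp_inf (atomic_measure w) = 0%E.
Proof.
apply: supp_inf_eq => [e e0|].
  by exists 0; [rewrite add0r|exact: (@support_atomic _ w 0)].
rewrite atomic_measureE//; apply: eseries0 => k _ _.
rewrite indicE memNset ?mulr0//= in_itv/=; apply/negP; rewrite -leNgt//.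
Qed.

Lemma supp_sup_atomic : supp_sup (atomic_measure w) = +oo%E.
Proof.
apply: supp_sup_eqy => M; exists (Num.truncn M).+1%:R; last exact: support_atomic.
exact/ltW/truncnS_gt.
Qed.

End atomic_support.

Section counting.
Context {R : realType} (r : nat) (r0 : (0 < r)%N).
Let mu := base_mu (@CountingConv R r r0).
(** The negative binomial mean [r * expR th / (1 - expR th)], written so that [expR th] occurs
    once. *)
Definition counting_mean (th : R) : R := r%:R / (1 - expR th) - r%:R.
Definition counting_link (z : R) : R := ln (z / (r%:R + z)).

Let rp : 0 < r%:R :> R. Proof. by rewrite ltr0n. Qed.

Let one_sub_exp (th : R) : (th%:E < 0)%E -> 0 < 1 - expR th.
Proof. by rewrite lte_fin subr_gt0 expR_lt1. Qed.

Let laplaceE (th : R) : (th%:E < 0)%E ->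
  laplace mu th = (expR (- (r%:R * ln (1 - expR th))))%:E.
Proof.
move=> th0; have h := one_sub_exp th0; rewrite /mu /= laplace_counting//.
by rewrite expRN expRM_natl lnK.
Qed.

Lemma steep_counting : steep_family mu 0%E 0%E (psi mu) counting_mean counting_link.
Proof.
have w0 k : 0 < ('C(r + k - 1, k)%:R%:nng : {nonneg R})%:num.
  by rewrite /= ltr0n bin_gt0; lia.
have dF (th : R) : (th%:E < 0)%E ->
    is_derive th 1 (fun th : R => - (r%:R * ln (1 - expR th))) (counting_mean th).
  move=> /one_sub_exp h.
  have dl : is_derive (1 - expR th) 1 (@ln R) (1 - expR th)^-1 by exact: is_derive1_ln.
  have dc : is_derive th 1 (@ln R \o (fun x => 1 - expR x))
      ((1 - expR th)^-1 * (0 - expR th)).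
    by apply: is_derive1_comp; apply: is_deriveB.
  rewrite (_ : (fun th => _) = - (r%:R *: (@ln R \o (fun x => 1 - expR x)))); last first.
    by apply/funext.
  apply: is_derive_eq; rewrite /counting_mean /GRing.scale/=; field.
  by rewrite gt_eqF.
have ginv (z : R) : (0 < z%:E)%E ->
    ((counting_link z)%:E < 0)%E /\ counting_mean (counting_link z) = z.
  rewrite lte_fin => z0.
  have zr : 0 < z / (r%:R + z) by rewrite divr_gt0// addr_gt0.
  split.
    rewrite lte_fin -expR_lt1 lnK//.
    by rewrite ltr_pdivrMr ?addr_gt0// mul1r ltrDr.
  rewrite /counting_mean lnK//; field.
  by rewrite addrK !gt_eqF// addr_gt0.
split => //.
- exact: supp_inf_atomic.
- exact: supp_sup_atomic.
- apply: Theta_interior => th; apply/idP/idP => [|th0]; last first.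
    by rewrite laplaceE// ltry.
  apply: contraTT; rewrite -!leNgt lee_fin => th0.
  by rewrite /mu/= laplace_counting_eqy.
- exact: psi_is_derive laplaceE dF.
- move=> x y y0 xy; have hy := one_sub_exp y0.
  rewrite /counting_mean ltrD2r ltr_pM2l// ltf_pV2 ?posrE//.
    by rewrite ltrD2l ltrN2 ltr_expR.
  by apply: (lt_trans hy); rewrite ltrD2l ltrN2 ltr_expR.
- move=> th th0; have h := one_sub_exp th0.
  rewrite lte_fin /counting_mean subr_gt0 ltr_pdivlMr// gtr_pMr// ltrBlDr ltrDl.
  exact: expR_gt0.
- move=> z K; rewrite lte_fin => z0.
  (* As [z * th < 0], the hypothesis gives [expR (K / r) <= 1 - expR th], which is at most
     [- th]. *)
  exists (- expR (K / r%:R)).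
    by rewrite lte_fin oppr_lt0 expR_gt0.
  move=> th th0; have h := one_sub_exp th0.
  rewrite /psi laplaceE// expRK opprK => Kth.
  have : K / r%:R <= ln (1 - expR th).
    rewrite ler_pdivrMr// mulrC; apply: (le_trans Kth).
    by rewrite gerDr mulr_ge0_le0// ltW.
  rewrite -ler_expR lnK// => hK.
  have := expR_ge1Dx th; lra.
Qed.

(** Since [1 + r / f th = expR (- th)], the product of these factors over one diagonal of a 2 by 2
    minor equals that over the other; clearing denominators gives the relation. *)
Lemma counting_relation (a0 a1 b0 b1 : R) :
  ((a0 + b0)%:E < 0)%E -> ((a1 + b0)%:E < 0)%E ->
  ((a0 + b1)%:E < 0)%E -> ((a1 + b1)%:E < 0)%E ->
  counting_mean (a1 + b1) * counting_mean (a0 + b0) *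
    (r%:R + counting_mean (a1 + b0) + counting_mean (a0 + b1)) =
  counting_mean (a1 + b0) * counting_mean (a0 + b1) *
    (r%:R + counting_mean (a1 + b1) + counting_mean (a0 + b0)).
Proof.
move=> /one_sub_exp + /one_sub_exp + /one_sub_exp + /one_sub_exp.
rewrite /counting_mean !expRD; move: (expR a0) (expR a1) (expR b0) (expR b1).
move=> u v x y h1 h2 h3 h4.
by field; rewrite !gt_eqF.
Qed.

End counting.

Section gamma_family.
Context {R : realType} (a gam : R) (a0 : 0 <= a) (gam1 : 1 <= gam).
Let mu := base_mu (GammaDensity a0 gam1).
Definition gamma_mean (th : R) : R := gam / (a - th).
Definition gamma_link (z : R) : R := a - gam / z.

Let gam0 : 0 < gam. Proof. exact: lt_le_trans gam1. Qed.

(** The value of the Gamma function at [gam]; it enters [psi] only through the additive constant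
    [ln G]. *)
Let G := fine (gamma_measure 1 gam setT).

Let GE : gamma_measure 1 gam setT = G%:E.
Proof.
rewrite /G fineK// ge0_fin_numE; first exact: gamma_measure_lty.
exact/ltW/gamma_measure_gt0.
Qed.

Let G0 : 0 < G.
Proof. by have := gamma_measure_gt0 gam1; rewrite GE lte_fin. Qed.

Let laplaceE (th : R) : (th%:E < a%:E)%E ->
  laplace mu th = (expR (ln G - gam * ln (a - th)))%:E.
Proof.
rewrite lte_fin -subr_gt0 => h; rewrite /mu/= laplace_gamma.
have := gamma_measure_scale h gam0; rewrite GE.
have P0 : 0 < (a - th) `^ gam by rewrite powR_gt0.
rewrite (_ : expR _ = G / (a - th) `^ gam); last first.
  by rewrite expRB (mulrC gam) expRM !lnK.
(* The scaling identity determines the mass; an infinite value would contradict the finiteness of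
   [G]. *)
case: (gamma_measure (a - th) gam setT) => [x| |].
- by rewrite -EFinM => -[->]; rewrite mulrC mulKf// gt_eqF.
- by rewrite gt0_muley// lte_fin.
- by rewrite gt0_muleNy// lte_fin.
Qed.

Let support_gamma x : 0 < x -> Defs.support mu x.
Proof.
move=> x0; apply: (@support_density _ _ (gamma_density a gam \_ `[0, +oo[) _
  (expR (- (a * (x + 1))) * x `^ (gam - 1))) => //.
- exact: measurable_gamma_density.
- exact: gamma_density_ge0.
- by rewrite mulr_gt0 ?expR_gt0 ?powR_gt0.
- move=> y /andP[xy yx]; rewrite patchE mem_set/=; last first.
    by rewrite in_itv/= andbT (le_trans (ltW x0)).
  rewrite /gamma_density; apply: ler_pM; rewrite ?expR_ge0 ?powR_ge0//.
    by rewrite ler_expR lerN2 ler_wpM2l.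
  apply: ge0_ler_powR; rewrite ?nnegrE ?subr_ge0// ?(ltW x0)//.
  by rewrite (le_trans (ltW x0)).
Qed.

Lemma steep_gamma : steep_family mu 0%E a%:E (psi mu) gamma_mean gamma_link.
Proof.
have dF (th : R) : (th%:E < a%:E)%E ->
    is_derive th 1 (fun th : R => ln G - gam * ln (a - th)) (gamma_mean th).
  rewrite lte_fin -subr_gt0 => h.
  have dl : is_derive (a - th) 1 (@ln R) (a - th)^-1 by exact: is_derive1_ln.
  have dc : is_derive th 1 (@ln R \o (fun x => a - x)) ((a - th)^-1 * (0 - 1)).
    by apply: is_derive1_comp; apply: is_deriveB.
  rewrite (_ : (fun th => _) =
    cst (ln G) - (gam *: (@ln R \o (fun x => a - x)))); last first.
    by apply/funext.
  by apply: is_derive_eq; rewrite /gamma_mean /GRing.scale/=; ring.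
split => //.
- apply: supp_inf_eq => [e e0|].
    exists (e / 2); first by rewrite add0r; lra.
    by apply: support_gamma; rewrite divr_gt0.
  rewrite /mu/= /gamma_measure; apply: integral0_eq => x /=; rewrite in_itv/= => x0.
  by rewrite patchE memNset//= in_itv/= andbT; apply/negP; rewrite -ltNge.
- apply: supp_sup_eqy => M; exists (Num.max M 1); first by rewrite le_max lexx.
  by apply: support_gamma; rewrite lt_max ltr01 orbT.
- apply: Theta_interior => th; apply/idP/idP => [|tha]; last first.
    by rewrite laplaceE// ltry.
  apply: contraTT; rewrite -!leNgt lee_fin => tha.
  by rewrite /mu/= laplace_gamma gamma_measure_eqy// subr_le0.
- exact: psi_is_derive laplaceE dF.
- move=> x y; rewrite lte_fin -subr_gt0 => y0 xy.
  rewrite /gamma_mean ltr_pM2l// ltf_pV2 ?posrE//; lra.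
- by move=> th; rewrite lte_fin -subr_gt0 => h; rewrite lte_fin divr_gt0.
- move=> z; rewrite lte_fin => z0; rewrite lte_fin /gamma_link /gamma_mean; split.
    by rewrite ltrBlDr ltrDl divr_gt0.
  by field; rewrite opprB addrC subrK !gt_eqF.
- move=> z K; rewrite lte_fin => z0.
  (* Obtained by replacing [z * th] with the larger [z * a] in the hypothesis and solving for
     [a - th]. *)
  exists (a - expR ((K + ln G - z * a) / gam)).
    by rewrite lte_fin ltrBlDr ltrDl expR_gt0.
  move=> th tha; have := tha; rewrite lte_fin -subr_gt0 => h.
  rewrite /psi laplaceE// expRK => Kth.
  have za : z * th <= z * a by rewrite ler_pM2l// ltW// -subr_gt0.
  have : (K + ln G - z * a) / gam <= ln (a - th).
    by rewrite ler_pdivrMr// mulrC; lra.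
  rewrite -ler_expR lnK//; lra.
Qed.

(** The reciprocal [(a - th) / gam] of the mean is affine, so the reciprocals on the two diagonals
    have equal sums. *)
Lemma gamma_relation (x0 x1 y0 y1 : R) :
  ((x0 + y0)%:E < a%:E)%E -> ((x1 + y0)%:E < a%:E)%E ->
  ((x0 + y1)%:E < a%:E)%E -> ((x1 + y1)%:E < a%:E)%E ->
  gamma_mean (x1 + y1) * gamma_mean (x0 + y0) *
    (0 + gamma_mean (x1 + y0) + gamma_mean (x0 + y1)) =
  gamma_mean (x1 + y0) * gamma_mean (x0 + y1) *
    (0 + gamma_mean (x1 + y1) + gamma_mean (x0 + y0)).
Proof.
rewrite !lte_fin => h1 h2 h3 h4; rewrite /gamma_mean.
by field; rewrite !subr_eq0 !gt_eqF.
Qed.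

End gamma_family.

Section poisson_family.
Context {R : realType} (rate : R) (rate0 : 0 < rate).
Let mu := base_mu (Poisson rate0).
Definition poisson_mean (th : R) : R := rate * expR th.
Definition poisson_link (z : R) : R := ln (z / rate).

Let laplaceE (th : R) : (th%:E < +oo)%E ->
  laplace mu th = (expR (rate * (expR th - 1)))%:E.
Proof. by move=> _; rewrite /mu/= laplace_poisson. Qed.

Lemma steep_poisson : steep_family mu 0%E +oo%E (psi mu) poisson_mean poisson_link.
Proof.
have w0 k : 0 < (NngNum (poisson_pmf_ge0 rate k))%:num.
  by rewrite /= /poisson_pmf rate0
    !mulr_gt0 ?exprn_gt0 ?invr_gt0 ?expR_gt0// ltr0n fact_gt0.
have dF (th : R) : (th%:E < +oo)%E ->
    is_derive th 1 (fun th : R => rate * (expR th - 1)) (poisson_mean th).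
  move=> _; rewrite (_ : (fun th => _) = rate *: (fun x => expR x - 1)).
    by apply: is_derive_eq; rewrite subr0.
  by apply/funext.
have ginv (z : R) : (0 < z%:E)%E ->
    ((poisson_link z)%:E < +oo)%E /\ poisson_mean (poisson_link z) = z.
  rewrite lte_fin ltry => z0; split => //.
  by rewrite /poisson_mean /poisson_link lnK ?posrE ?divr_gt0// mulrC divfK// gt_eqF.
split => //.
- exact: supp_inf_atomic.
- exact: supp_sup_atomic.
- by apply: Theta_interior => th; rewrite laplaceE ?ltry.
- exact: psi_is_derive laplaceE dF.
- by move=> x y _ xy; rewrite /poisson_mean ltr_pM2l// ltr_expR.
- by move=> th _; rewrite lte_fin mulr_gt0// expR_gt0.
- move=> z K; rewrite lte_fin => z0.
  have [//|_ fy] := ginv (z + 1); first by rewrite lte_fin addr_gt0.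
  set y := poisson_link (z + 1) in fy.
  (* The tangent at [y] has slope [z + 1], so [z * th - Psi th] is at most
     [z * y - Psi y - (th - y)]; the bound solves this for [th]. *)
  exists (y + (z * y - rate * (expR y - 1) - K)); rewrite ?ltry// => th _.
  rewrite /psi laplaceE ?ltry// expRK => Kth.
  have tangent : rate * (expR y - 1) + (z + 1) * (th - y) <= rate * (expR th - 1).
    rewrite -fy /poisson_mean (_ : expR th = expR y * expR (th - y)); last first.
      by rewrite -expRD; congr expR; ring.
    have : rate * expR y * (1 + (th - y)) <= rate * expR y * expR (th - y).
      by rewrite ler_wpM2l ?expR_ge1Dx// mulr_ge0 ?expR_ge0// ltW.
    lra.
  lra.
Qed.

Lemma poisson_relation (a0 a1 b0 b1 : R) :
  poisson_mean (a1 + b1) * poisson_mean (a0 + b0) =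
  poisson_mean (a1 + b0) * poisson_mean (a0 + b1).
Proof. by rewrite /poisson_mean !expRD; ring. Qed.

End poisson_family.

Section gaussian_family.
Context {R : realType} (mean sd : R) (sd0 : 0 < sd).
Let mu := base_mu (Gaussian mean sd0).
Definition gaussian_mean (th : R) : R := mean + sd ^+ 2 * th.
Definition gaussian_link (z : R) : R := (z - mean) / sd ^+ 2.

Let sd2 : 0 < sd ^+ 2. Proof. exact: exprn_gt0. Qed.

Let laplaceE (th : R) : (th%:E < +oo)%E ->
  laplace mu th = (expR (mean * th + sd ^+ 2 * th ^+ 2 / 2))%:E.
Proof. by move=> _; rewrite /mu/= laplace_normal// gt_eqF. Qed.

Let support_gaussian x : Defs.support mu x.
Proof.
have s0 : sd != 0 by rewrite gt_eqF.
pose M := `|x - mean| + 1.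
apply: (@support_density _ _ (normal_pdf mean sd) _
  (normal_peak sd * expR (- M ^+ 2 / (sd ^+ 2 *+ 2)))) => //.
- exact: measurable_normal_pdf.
- by move=> y; exact: normal_pdf_ge0.
- by rewrite mulr_gt0 ?expR_gt0 ?normal_peak_gt0.
- move=> y /andP[xy yx]; rewrite normal_pdfE// ler_wpM2l ?normal_peak_ge0//.
  rewrite ler_expR ler_pM2r ?invr_gt0 ?mulrn_wgt0// lerN2.
  rewrite -real_normK ?num_real// lerXn2r ?nnegrE// ?addr_ge0//.
  rewrite /M (_ : y - mean = x - mean + (y - x)); last by ring.
  apply: (le_trans (ler_normD _ _)); rewrite lerD2l ger0_norm ?subr_ge0//.
  by rewrite lerBlDl.
Qed.

Lemma steep_gaussian :
  steep_family mu -oo%E +oo%E (psi mu) gaussian_mean gaussian_link.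
Proof.
have dF (th : R) : (th%:E < +oo)%E ->
    is_derive th 1 (fun th : R => mean * th + sd ^+ 2 * th ^+ 2 / 2) (gaussian_mean th).
  move=> _; rewrite (_ : (fun th => _) =
      mean *: id + (sd ^+ 2 / 2) *: (fun x : R => x ^+ 2)).
    have d1 : is_derive th 1 (mean *: (id : R -> R)) (mean *: 1) by exact: is_deriveZ.
    have d2 : is_derive th 1 (fun x : R => x ^+ 2) (2 * th).
      by apply: is_derive_eq; rewrite /GRing.scale/=; ring.
    rewrite (_ : gaussian_mean th = mean *: 1 + (sd ^+ 2 / 2) *: (2 * th)).
      exact: is_deriveD.
    by rewrite /gaussian_mean /GRing.scale/=; field.
  by apply/funext => x; rewrite !fctE /GRing.scale/=; ring.
split => //.
- by apply: supp_inf_eqNy => M; exists M.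
- by apply: supp_sup_eqy => M; exists M.
- by apply: Theta_interior => th; rewrite laplaceE ?ltry.
- exact: psi_is_derive laplaceE dF.
- by move=> x y _ xy; rewrite /gaussian_mean ltrD2l ltr_pM2l.
- by move=> th _; exact: ltNyr.
- move=> z _; rewrite ltry; split => //.
  by rewrite /gaussian_mean /gaussian_link mulrC divfK ?gt_eqF// addrC subrK.
- move=> z K _; pose y := gaussian_link (z + 1).
  have fy : gaussian_mean y = z + 1.
    rewrite /gaussian_mean /y /gaussian_link mulrC divfK ?gt_eqF//.
    by rewrite addrC subrK.
  (* Again the tangent of slope [z + 1] at [y]; here the gap to the tangent is the square
     [sd ^+ 2 * (th - y) ^+ 2 / 2]. *)
  exists (y + (z * y - (mean * y + sd ^+ 2 * y ^+ 2 / 2) - K)); rewrite ?ltry// => th _.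
  rewrite /psi laplaceE ?ltry// expRK => Kth.
  have := mulr_ge0 (ltW sd2) (sqr_ge0 (th - y)).
  have : mean * (th - y) + sd ^+ 2 * y * (th - y) = (z + 1) * (th - y).
    by rewrite -fy /gaussian_mean; ring.
  lra.
Qed.

Lemma gaussian_relation (a0 a1 b0 b1 : R) :
  gaussian_mean (a1 + b1) + gaussian_mean (a0 + b0) =
  gaussian_mean (a1 + b0) + gaussian_mean (a0 + b1).
Proof. by rewrite /gaussian_mean; ring. Qed.

End gaussian_family.

(** * The critical ratio as a polynomial inequality, and the conclusion *)

Section critical.
Context {R : realType}.
Implicit Types s t k : R.

Let sqr_scale s t k : 0 < s ->
  ((t / s - 1) ^+ 2) * s ^+ 2 = t ^+ 2 - 2 * t * s + s ^+ 2 /\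
  (1 + k / s) * s ^+ 2 = s ^+ 2 + k * s.
Proof. by move=> s0; split; field; rewrite gt_eqF. Qed.

(** Both [t / s - 1] and the root are nonnegative, so the inequality may be squared and multiplied
    by [s ^+ 2]. *)
Lemma lt_critical_counting s t k : 0 <= k -> 0 < s -> s < t ->
  (t / s < 1 + Num.sqrt (1 + k / s)) = (t ^+ 2 < s * (k + 2 * t)).
Proof.
move=> k0 s0 st; have s2 : 0 < s ^+ 2 by rewrite exprn_gt0.
rewrite -ltrBlDl -[LHS](@ltr_pXn2r _ 2)// ?nnegrE ?sqrtr_ge0//; last first.
  by rewrite subr_ge0 ler_pdivlMr// mul1r ltW.
rewrite sqr_sqrtr ?addr_ge0 ?divr_ge0 ?(ltW s0)// -(ltr_pM2r s2).
have [-> ->] := sqr_scale t k s0.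
by apply/idP/idP; lra.
Qed.

Lemma gt_critical_counting s t k : 0 <= k -> 0 < s -> s < t ->
  (1 + Num.sqrt (1 + k / s) < t / s) = (s * (k + 2 * t) < t ^+ 2).
Proof.
move=> k0 s0 st; have s2 : 0 < s ^+ 2 by rewrite exprn_gt0.
rewrite -ltrBrDl -[LHS](@ltr_pXn2r _ 2)// ?nnegrE ?sqrtr_ge0//; last first.
  by rewrite subr_ge0 ler_pdivlMr// mul1r ltW.
rewrite sqr_sqrtr ?addr_ge0 ?divr_ge0 ?(ltW s0)// -(ltr_pM2r s2).
have [-> ->] := sqr_scale t k s0.
by apply/idP/idP; lra.
Qed.

End critical.

Section kappa_tame.
Context {R : realType} (mu : {measure set (measurableTypeR R) -> \bar R}).
Context (e : \bar R) (Psi f g : R -> R) (k : R).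
Hypothesis H : steep_family mu 0%E e Psi f g.
Local Notation dom th := (th%:E < e)%E.
Hypothesis rel : forall a0 a1 b0 b1,
  dom (a0 + b0) -> dom (a1 + b0) -> dom (a0 + b1) -> dom (a1 + b1) ->
  f (a1 + b1) * f (a0 + b0) * (k + f (a1 + b0) + f (a0 + b1)) =
  f (a1 + b0) * f (a0 + b1) * (k + f (a1 + b1) + f (a0 + b0)).

Lemma kappa_tame (s t : R) : 0 <= k -> 0 < s -> s < t ->
  t ^+ 2 < s * (k + 2 * t) ->
  exists2 delta : R, 0 < delta &
    forall m n : nat, (0 < m)%N -> (0 < n)%N ->
    forall (r : 'rV[R]_m) (c : 'rV[R]_n),
      bounded_margin mu s t r c -> tame mu delta r c.
Proof.
move=> k0 s0 st kst; have t0 := lt_trans s0 st.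
have pos th : dom th -> 0 < f th.
  by move=> dth; have := steep_range H dth; rewrite lte_fin.
pose W := t ^+ 2 / (s - t ^+ 2 / (k + 2 * t)).
(* The maximum with [s] provides the condition [s <= W] of [steep_tame]. *)
apply: (@steep_tame _ _ _ _ _ _ _ H s t (Num.max s W)); rewrite ?le_max ?lexx//.
apply: (maximal_entry_le H) => m n a b i0 j0 dab sr st0 sc0 mx.
rewrite le_max; apply/orP; right.
apply: (@kappa_entry_le _ m n s t _ (fun i => f (a i + b j0))
  (fun j => f (a i0 + b j)) (fun i j => f (a i + b j))) => //.
- exact/pos/dab.
- by move=> i; exact/pos/dab.
- by move=> j; exact/pos/dab.
- by move=> i j; exact: rel.
- by rewrite ltr_pdivrMr// ltr_wpDl// mulr_gt0.
Qed.

End kappa_tame.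

Theorem corollary1p23 (R : realType) (b : base_measure R) (s t : R) :
  0 < s -> s < t ->
  (((t / s)%:E < critical_ratio b s)%E ->
    exists2 delta : R, 0 < delta &
      forall (m n : nat), (0 < m)%N -> (0 < n)%N ->
      forall (r : 'rV[R]_m) (c : 'rV[R]_n),
        bounded_margin (base_mu b) s t r c -> tame (base_mu b) delta r c) /\
  ((critical_ratio b s < (t / s)%:E)%E ->
    exists (r c : forall n : nat, 'rV[R]_n.+1),
      (forall n, bounded_margin (base_mu b) s t (r n) (c n)) /\
      exists Z : forall n : nat, 'M[R]_n.+1,
        (forall n, is_typical_table (base_mu b) (r n) (c n) (Z n)) /\
        exists i j : forall n : nat, 'I_n.+1,
          Z n (i n) (j n) @[n --> \oo] --> +oo).
Proof.
move=> s0 st; have t0 := lt_trans s0 st.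
case: b => [r r0|a g a0 g1|rate rate0|mean sd sd0]; split; rewrite [critical_ratio _ _]/=.
- rewrite lte_fin lt_critical_counting// => h.
  exact: (kappa_tame (@steep_counting R r r0) (@counting_relation R r)
    (ler0n _ _) s0 st h).
- rewrite lte_fin gt_critical_counting// => h.
  exact: (steep_diverge (@steep_counting R r r0) (ler0n _ _) s0 st h
    (@counting_relation R r)).
(* Gamma is the case [k = 0], where [t ^+ 2 < s * (2 * t)] reads [t < 2 * s]. *)
- rewrite lte_fin ltr_pdivrMr// => h.
  apply: (kappa_tame (steep_gamma a0 g1) (@gamma_relation R a g)) => //.
  by rewrite add0r mulrA expr2 ltr_pM2r// mulrC.
- rewrite lte_fin ltr_pdivlMr// => h.
  apply: (steep_diverge (steep_gamma a0 g1) (lexx _) s0 st _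
    (@gamma_relation R a g)).
  by rewrite add0r mulrA expr2 ltr_pM2r// mulrC.
- move=> _; have H := steep_poisson rate0.
  have pos (th : R) : 0 < poisson_mean rate th by rewrite mulr_gt0 ?expR_gt0.
  apply: (steep_tame H (W := Num.max s (t ^+ 2 / s))); rewrite ?le_max ?lexx//.
  apply: (maximal_entry_le H) => m n x y i0 j0 dab sr st0 sc0 mx.
  rewrite le_max; apply/orP; right.
  apply: (product_entry_le sc0 st0 sr) => //.
  by move=> i j; exact: poisson_relation.
(* The critical ratio is infinite, so no finite [t / s] exceeds it. *)
- by rewrite ltNge leey.
- move=> _; have H := steep_gaussian mean sd0.
  apply: (steep_tame H (W := Num.max s (2 * t - s))); rewrite ?le_max ?lexx ?ltNyr//.
  apply: (maximal_entry_le H) => m n x y i0 j0 dab sr st0 sc0 mx.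
  rewrite le_max; apply/orP; right.
  apply: (sum_entry_le sc0 st0 sr).
  by move=> i j; exact: gaussian_relation.
- by rewrite ltNge leey.
Qed.
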